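(* Let $\mathbb K\in\{\mathbb R,\mathbb C\}$, $b\in\mathbb K^{10}$, let $\pi_1$ be the Lie–Poisson bivector on $\mathfrak{gl}(3,\mathbb K)^*$ and $$\pi_2=\pi_2(b)=[X_b,\pi_1]-\pi_1(Q_b)\wedge\frac{\partial}{\partial x_0}+x_0\pi_1 ,$$ and let $B,K_1,K_2,K_3,Q_b,C_2,C_3,m_b,p$ be as in the context. Then the functions $$x_0,\ B,\ K_1,\ K_2,\ K_3,\ p^*Q_b$$ on $\mathfrak{gl}(3,\mathbb K)^*$ pairwise Poisson commute with respect to any bivector $\lambda_1\pi_1+\lambda_2\pi_2$, $(\lambda_1,\lambda_2)\in\mathbb K^2$. In particular, the functions $$Q_b,\ X_bC_2,\ m_b-X_bQ_b,\ C_2,\ C_3$$ form an involutive family of functions with respect to the Lie–Poisson bivector $P$ on $\mathfrak{sl}(3,\mathbb K)^*$.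
   Context: $[\cdot,\cdot]$ is the Schouten bracket, normalized by $[X,f]=Xf$, $[X,Y]$ the Lie bracket for vector fields, $[R,Q]=-(-1)^{(r-1)(q-1)}[Q,R]$, $[R,Q\wedge S]=[R,Q]\wedge S+(-1)^{(r-1)q}Q\wedge[R,S]$ for $R,Q$ of degrees $r,q$. For a bivector $\eta$ and a function $f$, $\eta(f):=[\eta,f]$ (contraction of $\eta$ with $df$ over the second index), and $\{g,f\}_\eta=\eta(f)g$; functions commute with respect to $\eta$ (are in involution) if their $\eta$-brackets vanish. $P$ is the Lie–Poisson bivector on $\mathfrak{sl}(3,\mathbb K)^*$. Coordinates on $\mathfrak{sl}(3,\mathbb K)^*$: $x_{ij}$ ($i\ne j$), $y_{13}=x_{11}-x_{33}$, $y_{23}=x_{22}-x_{33}$, the linear functions given by the matrices $E_{ij}$, $E_{11}-E_{33}$, $E_{22}-E_{33}$; the bracket of $P$ is $\{x_{ij},x_{kl}\}=\delta_{jk}x_{il}-\delta_{il}x_{kj}$. $\mathfrak{sl}(3,\mathbb K)$ acts on multivector fields and functions on $\mathfrak{sl}(3,\mathbb K)^*$ by Lie derivatives along $P(x)$, $x\in\mathfrak{sl}(3,\mathbb K)$. $W^*$ is the 10-dimensional irreducible submodule (isomorphic to $S^3(V^* )$, $V$ the natural representation) of the space of quadratic vector fields generated by the zero weight vector $$\begin{aligned}X_0={}&((4y_{13}-2y_{23})x_{12}-6x_{13}x_{32})\tfrac{\partial}{\partial x_{12}}+((-4y_{13}+2y_{23})x_{13}+6x_{12}x_{23})\tfrac{\partial}{\partial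 x_{13}}\\&+((2y_{13}-4y_{23})x_{21}+6x_{23}x_{31})\tfrac{\partial}{\partial x_{21}}+((-2y_{13}+4y_{23})x_{23}-6x_{13}x_{21})\tfrac{\partial}{\partial x_{23}}\\&+((-2y_{13}-2y_{23})x_{31}-6x_{32}x_{21})\tfrac{\partial}{\partial x_{31}}+((2y_{13}+2y_{23})x_{32}+6x_{12}x_{31})\tfrac{\partial}{\partial x_{32}}\\&+(-2y_{13}^2-4y_{13}y_{23}+4y_{23}^2)\tfrac{\partial}{\partial y_{13}}+(-4y_{13}^2+4y_{13}y_{23}+2y_{23}^2)\tfrac{\partial}{\partial y_{23}}.\end{aligned}$$ All weight spaces of $W^*$ are one-dimensional, and they are generated by $X_0$ and, up to nonzero constant factors, $X_1=-[P(x_{12}),X_0]$, $X_2=-[P(x_{13}),X_0]$, $X_3=-[P(x_{21}),X_0]$, $X_4=-[P(x_{23}),X_0]$, $X_5=-[P(x_{31}),X_0]$, $X_6=-[P(x_{32}),X_0]$, $X_7=-[P(x_{12}),X_6]$, $X_8=-[P(x_{13}),X_4]$, $X_9=-[P(x_{31}),X_3]$. For $b=(b_0,\dots,b_9)$ put $X_b=b_0X_0+\cdots+b_9X_9$. $U$ is the 27-dimensional irreducible submodule (highest weight $2\omega_1+2\omega_2$) of the space of homogeneous quadratic polynomials on $\mathfrak{sl}(3,\mathbb K)^*$, i.e. the submodule generated by $x_{13}^2$. For each $b$, $Q_b\in U$ denotes a quadratic polynomial with $[[X_b,P],[X_b,P]]=2P(Q_b)\wedge P$ (it exists for every $b$),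 and $m_b$ denotes a cubic homogeneous polynomial on $\mathfrak{sl}(3,\mathbb K)^*$ with $[X_b,P(Q_b)]=P(m_b)$ (it exists for every $b$). On $\mathfrak{gl}(3,\mathbb K)^*=\mathfrak{sl}(3,\mathbb K)^*\oplus\mathbb K^*$ ($\mathbb K^*$ the dual line of the centre), $x_0$ is a linear coordinate proportional (with nonzero factor) to the trace function, vanishing on $\mathfrak{sl}(3,\mathbb K)^*$; $p:\mathfrak{gl}(3,\mathbb K)^*\to\mathfrak{sl}(3,\mathbb K)^*$ is the natural projection. In the formula for $\pi_2(b)$, $X_b$ and $Q_b$ are treated as objects on $\mathfrak{gl}(3,\mathbb K)^*$ independent of $x_0$ and without $\partial/\partial x_0$ component; $\pi_2(b)$ is a Poisson bivector compatible with $\pi_1$. $C_2$, $C_3$ are the quadratic and cubic Casimir functions of $P$ corresponding to $\mathrm{Trace}(x^2)$, $\mathrm{Trace}(x^3)$ under the identification $\mathfrak{sl}(3,\mathbb K)\cong\mathfrak{sl}(3,\mathbb K)^*$ by the Killing form, and $$B=p^*C_2,\quad K_1=p^*C_3,\quad K_2=p^*(X_bC_2)+Bx_0,\quad K_3=-3p^*(m_b-X_bQ_b)+3(p^*Q_b)x_0+x_0^3 .$$ *)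

(* Defs.v *)
From HB Require Import structures.
From mathcomp Require Import all_boot all_order all_algebra.
From mathcomp Require Import complex reals.
From mathcomp Require Import mpoly.

Set Implicit Arguments.
Unset Strict Implicit.
Unset Printing Implicit Defensive.

Import GRing.Theory.

Local Open Scope ring_scope.

Inductive real_or_complex : fieldType -> Prop :=
| RealNumbers (R : realType) : real_or_complex R
| ComplexNumbers (R : realType) : real_or_complex R[i].

(* Polynomial multivector fields on K^n: [R A] is the coefficient of
   d/dx_{a_1} /\ ... /\ d/dx_{a_k}, where A = {a_1 < ... < a_k}. *)
Notation mvfield K n := {ffun {set 'I_n} -> {mpoly K[n]}}.

Section Multivectors.

Variables (K : fieldType) (n : nat).
Implicit Types (A B C : {set 'I_n}) (R Q eta : mvfield K n).
Implicit Types (f g : {mpoly K[n]}) (i : 'I_n).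

Definition inversions A B : nat :=
  #|[set ij : 'I_n * 'I_n | [&& ij.1 \in A, ij.2 \in B & (ij.2 < ij.1)%N]]|.

Definition wedge R Q : mvfield K n :=
  [ffun C : {set 'I_n} => \sum_(A : {set 'I_n} | A \subset C)
     (-1) ^+ inversions A (C :\: A) * (R A * Q (C :\: A))].

Definition fun_mv f : mvfield K n := [ffun C : {set 'I_n} => if C == set0 then f else 0].

Definition partial i : mvfield K n := [ffun C : {set 'I_n} => (C == [set i])%:R].

Definition mv_deriv i R : mvfield K n := [ffun C : {set 'I_n} => (R C)^`M(i)].

(* Left and right derivatives of the exterior algebra with respect to the odd
   generator [partial i]: R = partial i /\ lcontract i R + R', and
   R = rcontract i R /\ partial i + R', where R' does not involve partial i. *)
Definition lcontract i R : mvfield K n :=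
  [ffun C : {set 'I_n} => if i \in C then 0 else (-1) ^+ inversions [set i] C * R (i |: C)].

Definition rcontract i R : mvfield K n :=
  [ffun C : {set 'I_n} => if i \in C then 0 else (-1) ^+ inversions C [set i] * R (i |: C)].

(* With these signs [X, f] = X f, [X, Y] is the Lie bracket of vector fields,
   [R, Q] = - (-1)^((r-1)(q-1)) [Q, R] and
   [R, Q /\ S] = [R, Q] /\ S + (-1)^((r-1)q) Q /\ [R, S]. *)
Definition schouten R Q : mvfield K n :=
  \sum_(i < n) (wedge (rcontract i R) (mv_deriv i Q)
                - wedge (mv_deriv i R) (lcontract i Q)).

(* eta(f) *)
Definition ham eta f : mvfield K n := schouten eta (fun_mv f).

(* X f, for a vector field X *)
Definition vapp (X : mvfield K n) f : {mpoly K[n]} :=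
  schouten X (fun_mv f) set0.

(* {g, f}_eta *)
Definition pbracket eta g f : {mpoly K[n]} := vapp (ham eta f) g.

Definition in_involution eta (s : seq {mpoly K[n]}) : Prop :=
  {in s &, forall g f, pbracket eta g f = 0}.

End Multivectors.

Section MatrixLieAlgebras.

Variable K : fieldType.

Definition lie_bracket (A B : 'M[K]_3) : 'M[K]_3 := A *m B - B *m A.

Section WithBasis.

(* e is a basis of a Lie subalgebra g of gl(3, K); the variable 'X_i is the
   linear function on g^* given by e_i. *)
Variables (n : nat) (e : n.-tuple 'M[K]_3).

Definition linear_function (A : 'M[K]_3) : {mpoly K[n]} :=
  \sum_(i < n) coord e i A *: 'X_i.

Definition lie_poisson : mvfield K n :=
  \sum_(i < n) \sum_(j < n | (i < j)%N)
    wedge (fun_mv (linear_function (lie_bracket e`_i e`_j)))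
          (wedge (partial K i) (partial K j)).

(* acts on row vectors of coordinates *)
Definition ad_mx (A : 'M[K]_3) : 'M[K]_n :=
  \matrix_(i, j) coord e j (lie_bracket A e`_i).

Definition killing (A B : 'M[K]_3) : K := \tr (ad_mx A *m ad_mx B).

Definition killing_mx : 'M[K]_n := \matrix_(i, j) killing e`_i e`_j.

(* The generic point xi of g^*, seen as an element of g through the Killing
   form: the sum of the c_i e_i with \sum_i c_i killing e_i e_j = 'X_j for
   all j. *)
Definition killing_point : 'M[{mpoly K[n]}]_3 :=
  \sum_(i < n) (\sum_(j < n) invmx killing_mx j i *: 'X_j)
                *: map_mx (@mpolyC n K) e`_i.

End WithBasis.

(* E i j is numbered from 1 *)
Definition E (i j : nat) : 'M[K]_3 :=
  \matrix_(k, l) ((k.+1 == i) && (l.+1 == j))%:R.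

Definition sl3_basis : 8.-tuple 'M[K]_3 :=
  [tuple E 1 2; E 1 3; E 2 1; E 2 3; E 3 1; E 3 2;
         E 1 1 - E 3 3; E 2 2 - E 3 3].

(* The last coordinate on gl(3, K)^*, x_0, is the linear function given by
   c times the identity matrix, that is, c times the trace function. *)
Definition gl3_basis (c : K) : 9.-tuple 'M[K]_3 :=
  [tuple of rcons sl3_basis c%:M].

End MatrixLieAlgebras.

(* Indices of the coordinates, in the order of [sl3_basis]. *)
Notation i12 := (@Ordinal 8 0 isT).
Notation i13 := (@Ordinal 8 1 isT).
Notation i21 := (@Ordinal 8 2 isT).
Notation i23 := (@Ordinal 8 3 isT).
Notation i31 := (@Ordinal 8 4 isT).
Notation i32 := (@Ordinal 8 5 isT).
Notation j13 := (@Ordinal 8 6 isT).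
Notation j23 := (@Ordinal 8 7 isT).

Section SL3.

Variable K : fieldType.

Definition x12 : {mpoly K[8]} := 'X_i12.
Definition x13 : {mpoly K[8]} := 'X_i13.
Definition x21 : {mpoly K[8]} := 'X_i21.
Definition x23 : {mpoly K[8]} := 'X_i23.
Definition x31 : {mpoly K[8]} := 'X_i31.
Definition x32 : {mpoly K[8]} := 'X_i32.
Definition y13 : {mpoly K[8]} := 'X_j13.
Definition y23 : {mpoly K[8]} := 'X_j23.

Definition P : mvfield K 8 := lie_poisson (sl3_basis K).

Local Notation "f '\dd' i" := (wedge (fun_mv f) (partial K i))
  (at level 45).

Definition X0 : mvfield K 8 :=
    ((4 * y13 - 2 * y23) * x12 - 6 * x13 * x32) \dd i12
  + ((- 4 * y13 + 2 * y23) * x13 + 6 * x12 * x23) \dd i13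
  + ((2 * y13 - 4 * y23) * x21 + 6 * x23 * x31) \dd i21
  + ((- 2 * y13 + 4 * y23) * x23 - 6 * x13 * x21) \dd i23
  + ((- 2 * y13 - 2 * y23) * x31 - 6 * x32 * x21) \dd i31
  + ((2 * y13 + 2 * y23) * x32 + 6 * x12 * x31) \dd i32
  + (- 2 * y13 ^+ 2 - 4 * y13 * y23 + 4 * y23 ^+ 2) \dd j13
  + (- 4 * y13 ^+ 2 + 4 * y13 * y23 + 2 * y23 ^+ 2) \dd j23.

Definition X1 : mvfield K 8 := - schouten (ham P x12) X0.
Definition X2 : mvfield K 8 := - schouten (ham P x13) X0.
Definition X3 : mvfield K 8 := - schouten (ham P x21) X0.
Definition X4 : mvfield K 8 := - schouten (ham P x23) X0.
Definition X5 : mvfield K 8 := - schouten (ham P x31) X0.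
Definition X6 : mvfield K 8 := - schouten (ham P x32) X0.
Definition X7 : mvfield K 8 := - schouten (ham P x12) X6.
Definition X8 : mvfield K 8 := - schouten (ham P x13) X4.
Definition X9 : mvfield K 8 := - schouten (ham P x31) X3.

Definition Xb (b : 'rV[K]_10) : mvfield K 8 :=
  \sum_(i < 10) b 0 i *: [:: X0; X1; X2; X3; X4; X5; X6; X7; X8; X9]`_i.

(* Elements of sl(3, K) are the linear functions on its dual, that is, the
   polynomials homogeneous of degree 1. *)
Definition is_submodule (M : {mpoly K[8]} -> Prop) : Prop :=
  [/\ M 0,
      forall f g, M f -> M g -> M (f + g),
      forall (a : K) f, M f -> M (a *: f)
    & forall x f, x \is 1.-homog -> M f -> M (vapp (ham P x) f)].

Definition in_U (q : {mpoly K[8]}) : Prop :=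
  forall M : {mpoly K[8]} -> Prop, is_submodule M -> M (x13 ^+ 2) -> M q.

Definition is_Qb (b : 'rV[K]_10) (Q : {mpoly K[8]}) : Prop :=
  in_U Q /\
  schouten (schouten (Xb b) P) (schouten (Xb b) P) = 2 *: wedge (ham P Q) P.

Definition is_mb (b : 'rV[K]_10) (Q m : {mpoly K[8]}) : Prop :=
  m \is 3.-homog /\ schouten (Xb b) (ham P Q) = ham P m.

Definition C2 : {mpoly K[8]} := \tr (killing_point (sl3_basis K) ^+ 2).
Definition C3 : {mpoly K[8]} := \tr (killing_point (sl3_basis K) ^+ 3).

(* p^* on functions is [mwiden]; this is the extension of a multivector field
   to gl(3, K)^*, independent of x_0 and without d/dx_0 component. *)
Definition mv_extend (R : mvfield K 8) : mvfield K 9 :=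
  [ffun C : {set 'I_9} => if ord_max \in C then 0
             else mwiden (R [set i | widen_ord (leqnSn 8) i \in C])].

Definition x0 : {mpoly K[9]} := 'X_ord_max.

Definition pi1 (c : K) : mvfield K 9 := lie_poisson (gl3_basis c).

Definition pi2 (c : K) (b : 'rV[K]_10) (Q : {mpoly K[8]}) : mvfield K 9 :=
  schouten (mv_extend (Xb b)) (pi1 c)
  - wedge (ham (pi1 c) (mwiden Q)) (partial K ord_max)
  + wedge (fun_mv x0) (pi1 c).

Definition B : {mpoly K[9]} := mwiden C2.
Definition K1 : {mpoly K[9]} := mwiden C3.
Definition K2 (b : 'rV[K]_10) : {mpoly K[9]} :=
  mwiden (vapp (Xb b) C2) + B * x0.
Definition K3 (b : 'rV[K]_10) (Q m : {mpoly K[8]}) : {mpoly K[9]} :=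
  - 3 * mwiden (m - vapp (Xb b) Q) + 3 * mwiden Q * x0 + x0 ^+ 3.

End SL3.

(* Main.v *)
Require Import Defs.
From HB Require Import structures.
From Stdlib Require Import BinInt.
From mathcomp Require Import all_boot all_order all_algebra.
From mathcomp Require Import complex reals.
From mathcomp Require Import mpoly ring ssrZ.

Set Implicit Arguments.
Unset Strict Implicit.
Unset Printing Implicit Defensive.

Import GRing.Theory.

Local Open Scope ring_scope.

(** Write P' = [X_b, P], F = X_b C_2 and M = m_b - X_b Q_b, and let {g, f} and
    {g, f}' be the brackets of P and P'.  The bracket of P' is the Lie derivative
    of that of P:

      {g, f}' = X_b {g, f} - {X_b g, f} - {g, X_b f}.

    The theorem is a Lenard scheme, resting on four formulas valid for all g:

      {g, C_2}' = - {g, F},       {g, C_3}' = 0,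
      {g, Q_b}' = {g, M},         {g, F}' = C_2 {g, Q_b}.

    The first two hold because C_2 and C_3 are Casimir functions of P and
    X_b C_3 = 0; the third rewrites [X_b, P(Q_b)] = P(m_b).  Given the four
    formulas, every bracket vanishes formally ([lenard_involution],
    [lenard_involution_deformed]); for instance
    {Q_b, F} = - {Q_b, C_2}' = {C_2, Q_b}' = {C_2, M} = 0 and
    {F, M} = {F, Q_b}' = - {Q_b, F}' = - C_2 {Q_b, Q_b} = 0.

    The fourth formula is the heart of the proof ([deformed_F]).  A bivector of
    rank at least 4 is a nonzerodivisor on vector fields for the wedge product, and
    P has rank 6, so it is enough to compare the wedge products with P
    ([wedge_P_inj]).  By the definition of Q_b, the product of P(Q_b) with P is half
    of [P', P'], that is, the jacobiator of P'.  What remains is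

      P'(F) /\ P = C_2 [P', P'] / 2,

    where Q_b does not occur any more ([ham_F_wedge_P]).  Up to a common scalar this
    is an identity between polynomials with integer coefficients in the 8
    coordinates and the 10 parameters b_i.  It is checked by computing normal forms,
    as are X_b C_3 = 0 and the invariance of C_2 and C_3.  The computation is tied
    to the fields of the statement through tables of their coefficients.

    On the dual of gl(3), the six functions are polynomials in x_0 and in the
    pullbacks of Q_b, F, M, C_2, C_3, so these generators are enough.  On pullbacks
    pi_1 restricts to P and pi_2 to P' + x_0 P, while the bracket of x_0 with the
    pullback of f is zero for pi_1 and, up to sign, {Q_b, f} for pi_2. *)

(** * Multivector fields in coordinates *)

Lemma mderiv_var (K : fieldType) n (i j : 'I_n) :
  ('X_j : {mpoly K[n]})^`M(i) = (i == j)%:R.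
Proof.
rewrite mderivX mnm1E eq_sym; case: eqP => [->|_]; last by rewrite scale0r.
rewrite scale1r (_ : (_ - _)%MM = 0%MM) ?mpolyX0 //.
by apply/mnmP=> k; rewrite mnmBE subnn mnmE.
Qed.

Section Derivations.

Variables (K : fieldType) (n : nat).
Local Notation A := {mpoly K[n]}.
Implicit Types (D : A -> A) (f g h : A).

Definition derivation D : Prop :=
  linear D /\ forall f g, D (f * g) = D f * g + f * D g.

(** Vector fields and brackets are compared through this lemma: the variables
    generate the polynomial ring. *)
Lemma derivation_ext D1 D2 : derivation D1 -> derivation D2 ->
  (forall i, D1 'X_i = D2 'X_i) -> D1 =1 D2.
Proof.
have D0 D : derivation D -> D 0 = 0.
  move=> [lD _]; have := lD 1 0 0; rewrite !scale1r addr0 => /esym/eqP.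
  by rewrite -subr_eq0 addrK => /eqP.
have D1' D : derivation D -> D 1 = 0.
  move=> [_ lD]; have := lD 1 1; rewrite !mulr1 !mul1r => /esym/eqP.
  by rewrite -subr_eq0 addrK => /eqP.
move=> hD1 hD2 eqX.
have eqM f g : D1 f = D2 f -> D1 g = D2 g -> D1 (f * g) = D2 (f * g).
  by rewrite hD1.2 hD2.2 => -> ->.
elim/mpolyind => [|c m f _ _ IH]; first by rewrite !D0.
rewrite hD1.1 hD2.1 IH; congr (_ *: _ + _).
rewrite mpolyXE_id; apply: (big_ind (fun f => D1 f = D2 f)) => [||i _].
- by rewrite !D1'.
- exact: eqM.
elim: (m i) => [|k IHk]; first by rewrite expr0 !D1'.
by rewrite exprS; apply: eqM.
Qed.

Lemma derivation_commutator D1 D2 : derivation D1 -> derivation D2 ->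
  derivation (fun f => D1 (D2 f) - D2 (D1 f)).
Proof.
move=> [l1 m1] [l2 m2]; split=> [a f g|f g].
  by rewrite l2 l1 l1 l2 scalerBr opprD addrACA.
have a1 f' g' : D1 (f' + g') = D1 f' + D1 g'.
  by have := l1 1 f' g'; rewrite !scale1r.
have a2 f' g' : D2 (f' + g') = D2 f' + D2 g'.
  by have := l2 1 f' g'; rewrite !scale1r.
by rewrite m2 m1 a1 a2 !m1 !m2; ring.
Qed.

Lemma derivationB D1 D2 : derivation D1 -> derivation D2 ->
  derivation (fun f => D1 f - D2 f).
Proof.
move=> [l1 m1] [l2 m2]; split=> [a f g|f g].
  by rewrite l1 l2 scalerBr opprD addrACA.
by rewrite m1 m2; ring.
Qed.

End Derivations.

Section Coordinates.

Variables (K : fieldType) (n : nat).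
Local Notation A := {mpoly K[n]}.
Implicit Types (R Q S V W X : mvfield K n) (f g h : A) (i j l : 'I_n).
Implicit Types C D : {set 'I_n}.

(** This is the bracket of the i-th and the j-th coordinate under [R]; the sign
    makes it antisymmetric in (i, j), whereas [R] is indexed by unordered sets. *)
Definition mvcoef R i j : A :=
  if i == j then 0 else (-1) ^+ (j < i)%N * R [set i; j].

Lemma inversions11 i j : inversions [set i] [set j] = (j < i)%N.
Proof.
rewrite /inversions; case: ltnP => ij /=.
  rewrite (_ : [set _ | _] = [set (i, j)]) ?cards1 //.
  apply/setP=> -[a b]; rewrite !inE /= xpair_eqE.
  by case: eqP => //= ->; case: eqP => //= ->.
apply: eq_card0 => -[a b]; rewrite !inE /=; apply/negP.
by case/and3P => /eqP-> /eqP->; rewrite ltnNge ij.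
Qed.

Lemma mvcoefC R i j : mvcoef R j i = - mvcoef R i j.
Proof.
rewrite /mvcoef eq_sym setUC; case: eqP => [_|/eqP ij]; first by rewrite oppr0.
case: ltngtP ij => //= [_|_|/val_inj->]; last by rewrite eqxx.
- by rewrite expr0 expr1 mul1r mulN1r.
- by rewrite expr0 expr1 mul1r mulN1r opprK.
Qed.

Lemma mvcoefD R Q i j : mvcoef (R + Q) i j = mvcoef R i j + mvcoef Q i j.
Proof. by rewrite /mvcoef !ffunE; case: eqP => _; rewrite ?addr0 ?mulrDr. Qed.

Lemma mvcoefZ (a : K) R i j : mvcoef (a *: R) i j = a *: mvcoef R i j.
Proof. by rewrite /mvcoef !ffunE; case: eqP => _; rewrite ?scaler0 ?scalerAr. Qed.

Lemma mvcoef_lcontract R i j : lcontract i R [set j] = mvcoef R i j.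
Proof. by rewrite /lcontract ffunE inE inversions11 /mvcoef. Qed.

Lemma mvcoef_rcontract R i j : rcontract j R [set i] = mvcoef R i j.
Proof.
rewrite /rcontract ffunE inE inversions11 /mvcoef eq_sym.
by rewrite [j |: _]setUC.
Qed.

Lemma inversions0l C : inversions set0 C = 0%N.
Proof. by apply: eq_card0 => ij; rewrite !inE. Qed.

Lemma inversions0r C : inversions C set0 = 0%N.
Proof. by apply: eq_card0 => ij; rewrite !inE andbF. Qed.

Lemma schoutenE R Q C : schouten R Q C =
  \sum_i (wedge (rcontract i R) (mv_deriv i Q) C
          - wedge (mv_deriv i R) (lcontract i Q) C).
Proof. by rewrite sum_ffunE; apply: eq_bigr => i _; rewrite !ffunE. Qed.

Lemma lcontract_fun i f : lcontract i (fun_mv f) = 0.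
Proof.
apply/ffunP=> C; rewrite !ffunE.
case: ifP => // _; rewrite (_ : _ == set0 = false) ?mulr0 //.
by apply/set0Pn; exists i; rewrite setU11.
Qed.

Lemma wedge0r R C : wedge R 0 C = 0.
Proof. by rewrite ffunE big1 // => D _; rewrite ffunE !mulr0. Qed.

Lemma mv_deriv_fun i f : mv_deriv i (fun_mv f) = fun_mv f^`M(i).
Proof. by apply/ffunP=> C; rewrite !ffunE; case: eqP => // _; rewrite mderiv0. Qed.

Lemma wedge_funr R f C : wedge R (fun_mv f) C = R C * f.
Proof.
rewrite ffunE (bigD1 C) //= setDv inversions0r ffunE eqxx mul1r big1 ?addr0 //.
move=> D /andP[sDC neDC]; rewrite ffunE setD_eq0.
by case: ifP => [sCD|_]; rewrite ?mulr0 //; rewrite eqEsubset sDC sCD in neDC.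
Qed.

Lemma wedge_funl R f C : wedge (fun_mv f) R C = f * R C.
Proof.
rewrite ffunE (bigD1 set0) ?sub0set //= setD0 inversions0l ffunE eqxx mul1r.
by rewrite big1 ?addr0 // => D /andP[_ /negPf D0]; rewrite ffunE D0 mul0r mulr0.
Qed.

Lemma schouten_fun R f C :
  schouten R (fun_mv f) C = \sum_i rcontract i R C * f^`M(i).
Proof.
rewrite schoutenE; apply: eq_bigr => i _.
by rewrite lcontract_fun wedge0r mv_deriv_fun wedge_funr subr0.
Qed.

Lemma vappE X f : vapp X f = \sum_i X [set i] * f^`M(i).
Proof.
rewrite /vapp schouten_fun; apply: eq_bigr => i _.
by rewrite ffunE inE inversions0l mul1r setU0.
Qed.

Lemma hamE R f i : ham R f [set i] = \sum_j mvcoef R i j * f^`M(j).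
Proof.
by rewrite /ham schouten_fun; apply: eq_bigr => j _; rewrite mvcoef_rcontract.
Qed.

Lemma pbracketE R g f :
  pbracket R g f = \sum_i \sum_j mvcoef R i j * f^`M(j) * g^`M(i).
Proof.
rewrite /pbracket vappE; apply: eq_bigr => i _.
by rewrite hamE mulr_suml.
Qed.

Lemma vapp_derivation X : derivation (vapp X).
Proof.
split=> [a f g|f g]; rewrite !vappE.
  rewrite scaler_sumr -big_split; apply: eq_bigr => i _ /=.
  by rewrite mderivD mderivZ mulrDr scalerAr.
rewrite mulr_suml mulr_sumr -big_split; apply: eq_bigr => i _ /=.
by rewrite mderivM; ring.
Qed.

Lemma vapp_linear X : linear (vapp X).
Proof. exact: (vapp_derivation X).1. Qed.

HB.instance Definition _ X :=
  GRing.isLinear.Build K A A _ (vapp X) (vapp_linear X).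

Lemma vappM X f g : vapp X (f * g) = vapp X f * g + f * vapp X g.
Proof. exact: (vapp_derivation X).2. Qed.

Lemma vappX X i : vapp X 'X_i = X [set i].
Proof.
rewrite vappE (bigD1 i) //= mderiv_var eqxx mulr1.
by rewrite big1 ?addr0 // => j /negPf ji; rewrite mderiv_var ji mulr0.
Qed.

Lemma vapp_partial i f : vapp (partial K i) f = f^`M(i).
Proof.
rewrite vappE (bigD1 i) //= ffunE eqxx mul1r big1 ?addr0 // => j /negPf ji.
by rewrite ffunE (inj_eq set1_inj) ji mul0r.
Qed.

Lemma pbracketC R f g : pbracket R f g = - pbracket R g f.
Proof.
rewrite !pbracketE exchange_big -sumrN; apply: eq_bigr => i _.
by rewrite -sumrN; apply: eq_bigr => j _; rewrite mvcoefC; ring.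
Qed.

Lemma pbracket_derivationl R f : derivation (fun g => pbracket R g f).
Proof. exact: vapp_derivation. Qed.

Lemma pbracket_derivationr R g : derivation (pbracket R g).
Proof.
have [lD mD] := pbracket_derivationl R g; split=> [a f h|f h].
  by rewrite !(pbracketC R g) lD opprD scalerN.
by rewrite !(pbracketC R g) mD opprD mulNr mulrN.
Qed.

Lemma pbracketMl R f g h :
  pbracket R (f * g) h = pbracket R f h * g + f * pbracket R g h.
Proof. exact: vappM. Qed.

HB.instance Definition _ R g :=
  GRing.isLinear.Build K A A _ (pbracket R g) (pbracket_derivationr R g).1.

Lemma pbracketDl R f g h :
  pbracket R (f + g) h = pbracket R f h + pbracket R g h.
Proof. exact: linearD. Qed.

Lemma pbracketNl R f h : pbracket R (- f) h = - pbracket R f h.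
Proof. exact: linearN. Qed.

Lemma ham_var R i j : ham R 'X_j [set i] = mvcoef R i j.
Proof.
rewrite hamE (bigD1 j) //= mderiv_var eqxx mulr1.
by rewrite big1 ?addr0 // => k /negPf kj; rewrite mderiv_var kj mulr0.
Qed.

Lemma pbracketXX R i j : pbracket R 'X_i 'X_j = mvcoef R i j.
Proof. by rewrite /pbracket vappX ham_var. Qed.

Lemma pbracketXE R i f : pbracket R 'X_i f = \sum_j mvcoef R i j * f^`M(j).
Proof. by rewrite /pbracket vappX hamE. Qed.

Lemma pbracketEl R g f : pbracket R g f = \sum_i pbracket R 'X_i f * g^`M(i).
Proof.
by rewrite pbracketE; apply: eq_bigr => i _; rewrite pbracketXE mulr_suml.
Qed.

Lemma pbracketD R Q g f : pbracket (R + Q) g f = pbracket R g f + pbracket Q g f.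
Proof.
rewrite !pbracketE -big_split; apply: eq_bigr => i _; rewrite -big_split.
by apply: eq_bigr => j _; rewrite mvcoefD /=; ring.
Qed.

Lemma pbracketZ (a : K) R g f : pbracket (a *: R) g f = a *: pbracket R g f.
Proof.
rewrite !pbracketE scaler_sumr; apply: eq_bigr => i _; rewrite scaler_sumr.
by apply: eq_bigr => j _; rewrite mvcoefZ -!scalerAl.
Qed.

Lemma pbracketN R g f : pbracket (- R) g f = - pbracket R g f.
Proof. by rewrite -scaleN1r pbracketZ scaleN1r. Qed.

(** Homogeneity of degree [d] in the exterior algebra. *)
Definition graded (d : nat) R : Prop := forall C, #|C| != d -> R C = 0.

Lemma graded_wedge r q R Q :
  graded r R -> graded q Q -> graded (r + q) (wedge R Q).
Proof.
move=> gR gQ C cC; rewrite ffunE big1 // => D sDC.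
have [cD|/gR->] := eqVneq #|D| r; last by rewrite mul0r mulr0.
rewrite gQ ?mulr0 // cardsD (setIidPr sDC) cD.
apply: contra cC => /eqP <-; rewrite subnKC // -cD; exact: subset_leq_card.
Qed.

Lemma graded_deriv r i R : graded r R -> graded r (mv_deriv i R).
Proof. by move=> gR C /gR RC; rewrite ffunE RC mderiv0. Qed.

Lemma graded_lcontract r i R : graded r.+1 R -> graded r (lcontract i R).
Proof.
move=> gR C cC; rewrite ffunE; case: ifP => // /negbT iC.
by rewrite gR ?mulr0 // cardsU1 iC.
Qed.

Lemma graded_rcontract r i R : graded r.+1 R -> graded r (rcontract i R).
Proof.
move=> gR C cC; rewrite ffunE; case: ifP => // /negbT iC.
by rewrite gR ?mulr0 // cardsU1 iC.
Qed.

Lemma graded_fun f : graded 0 (fun_mv f).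
Proof. by move=> C; rewrite cards_eq0 ffunE => /negPf->. Qed.

Lemma graded_partial i : graded 1 (partial K i).
Proof. by move=> C; rewrite ffunE; case: (C =P _) => // ->; rewrite cards1. Qed.

Lemma graded_ham R f : graded 2 R -> graded 1 (ham R f).
Proof.
move=> gR C cC; rewrite /ham schouten_fun big1 // => i _.
by rewrite (graded_rcontract _ gR) ?mul0r.
Qed.

Lemma graded_sum r (I : Type) (s : seq I) (p : pred I) (F : I -> mvfield K n) :
  (forall a, p a -> graded r (F a)) -> graded r (\sum_(a <- s | p a) F a).
Proof.
move=> gF; apply: big_ind => // [C _|R Q gR gQ C cC]; first by rewrite ffunE.
by rewrite ffunE gR // gQ // addr0.
Qed.

Lemma gradedN r R : graded r R -> graded r (- R).
Proof. by move=> gR C /gR RC; rewrite ffunE RC oppr0. Qed.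

Lemma gradedD r R Q : graded r R -> graded r Q -> graded r (R + Q).
Proof. by move=> gR gQ C cC; rewrite ffunE gR // gQ // addr0. Qed.

Lemma gradedZ r (a : K) R : graded r R -> graded r (a *: R).
Proof. by move=> gR C /gR RC; rewrite ffunE RC scaler0. Qed.

Lemma graded_schouten r q R Q :
  graded r.+1 R -> graded q.+1 Q -> graded (r + q).+1 (schouten R Q).
Proof.
move=> gR gQ; apply: graded_sum => i _; apply: gradedD.
  rewrite -addnS; apply: graded_wedge; last exact: graded_deriv.
  exact: graded_rcontract.
apply: gradedN; rewrite -addSn; apply: graded_wedge; first exact: graded_deriv.
exact: graded_lcontract.
Qed.

(** Only the splittings of [C] whose first part is a singleton contribute. *)
Lemma wedge_vectorl V R C : graded 1 V ->
  wedge V R C =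
  \sum_(i in C) (-1) ^+ inversions [set i] (C :\ i) * (V [set i] * R (C :\ i)).
Proof.
move=> gV; rewrite ffunE.
rewrite (bigID (fun D : {set 'I_n} => #|D| == 1%N)) /= [X in _ + X]big1 ?addr0.
  rewrite -(@big_imset _ _ _ _ _ (fun i => [set i]) _ (fun D =>
    (-1) ^+ inversions D (C :\: D) * (V D * R (C :\: D)))) /=.
    apply: eq_bigl => D; apply/andP/imsetP => [[sDC /cards1P[i Di]]|[i iC ->]].
      by exists i => //; rewrite Di sub1set in sDC *.
    by rewrite sub1set cards1.
  by move=> i j _ _ /set1_inj.
by move=> D /andP[_ /gV->]; rewrite mul0r mulr0.
Qed.

Lemma wedge_vectorr V R C : graded 1 V ->
  wedge R V C =
  \sum_(i in C) (-1) ^+ inversions (C :\ i) [set i] * (R (C :\ i) * V [set i]).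
Proof.
move=> gV; rewrite ffunE.
rewrite (bigID (fun D : {set 'I_n} => #|C :\: D| == 1%N)) /= [X in _ + X]big1 ?addr0.
  have CK i : i \in C -> C :\: (C :\ i) = [set i].
    by move=> iC; rewrite setDDr setDv set0U; apply/setIidPr; rewrite sub1set.
  rewrite [RHS](eq_bigr (fun i => (-1) ^+ inversions (C :\ i) (C :\: (C :\ i)) *
      (R (C :\ i) * V (C :\: (C :\ i))))); last by move=> i /CK->.
  rewrite -(@big_imset _ _ _ _ _ (fun i => C :\ i) _ (fun D =>
    (-1) ^+ inversions D (C :\: D) * (R D * V (C :\: D)))) /=.
    apply: eq_bigl => D; apply/andP/imsetP => [[sDC /cards1P[i Di]]|[i iC ->]].
      have iC : i \in C by have := set11 i; rewrite -Di inE => /andP[].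
      exists i => //; rewrite -Di setDDr setDv set0U.
      by apply/esym/setIidPr.
    by rewrite subD1set CK // cards1.
  by move=> i j iC jC /(congr1 (setD C)); rewrite !CK // => /set1_inj.
by move=> D /andP[_ /gV->]; rewrite !mulr0.
Qed.

Lemma graded_set1 V C : graded 0 V -> C != set0 -> V C = 0.
Proof. by move=> gV C0; apply: gV; rewrite cards_eq0. Qed.

Lemma setD2l i j : i != j -> [set i; j] :\ i = [set j].
Proof. by move=> ij; rewrite setU1K // inE. Qed.

Lemma setD2r i j : i != j -> [set i; j] :\ j = [set i].
Proof. by rewrite eq_sym setUC; exact: setD2l. Qed.

Lemma mvcoef_wedge V W i j : graded 1 V -> graded 1 W ->
  mvcoef (wedge V W) i j = V [set i] * W [set j] - V [set j] * W [set i].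
Proof.
move=> gV gW.
have lt_case (k l : 'I_n) : (k < l)%N ->
    mvcoef (wedge V W) k l = V [set k] * W [set l] - V [set l] * W [set k].
  move=> kl; have nkl : k != l by rewrite neq_ltn kl.
  rewrite /mvcoef (negPf nkl) ltnNge ltnW //= mul1r wedge_vectorl //.
  rewrite big_setU1 ?inE //= big_set1 setD2l // setD2r // !inversions11.
  by rewrite ltnNge ltnW //= kl expr1 mul1r mulN1r.
case: (ltngtP i j) => [|ji|/val_inj->]; first exact: lt_case.
  by rewrite mvcoefC lt_case // opprB.
by rewrite /mvcoef eqxx mulrC subrr.
Qed.

Lemma pbracket_wedge V W g f : graded 1 V -> graded 1 W ->
  pbracket (wedge V W) g f = vapp V g * vapp W f - vapp V f * vapp W g.
Proof.
move=> gV gW; rewrite pbracketE !vappE !big_distrlr /=.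
rewrite [X in _ = _ - X]exchange_big /= -sumrB; apply: eq_bigr => i _.
by rewrite -sumrB; apply: eq_bigr => j _; rewrite mvcoef_wedge //; ring.
Qed.

Lemma pbracket_fun_wedge h R g f :
  pbracket (wedge (fun_mv h) R) g f = h * pbracket R g f.
Proof.
rewrite !pbracketE mulr_sumr; apply: eq_bigr => i _; rewrite mulr_sumr.
apply: eq_bigr => j _; rewrite /mvcoef wedge_funl; case: eqP => _; last by ring.
by rewrite !mul0r mulr0.
Qed.

(** Homogeneity of [Y] reduces the sum over subsets to its extreme terms. *)
Lemma schouten_vectorE X Y i : graded 1 Y ->
  schouten X Y [set i] = vapp X (Y [set i]) - vapp Y (X [set i]).
Proof.
move=> gY; rewrite schoutenE !vappE -sumrB; apply: eq_bigr => l _.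
rewrite (wedge_vectorr _ _ (graded_deriv _ gY)) big_set1 setDv inversions0l.
rewrite mul1r !ffunE inE inversions0l setU0 mul1r; congr (_ - _).
rewrite (bigD1 [set i]) //= setDv inversions0r mul1r big1 ?addr0 => [|D].
  by rewrite !ffunE inE inversions0r setU0 mul1r mulrC.
case/andP=> sD neD; rewrite (graded_set1 (graded_lcontract _ gY)) ?mulr0 //.
by rewrite setD_eq0; apply: contra neD => sD'; rewrite eqEsubset sD.
Qed.

Lemma vapp_schouten X Y f : graded 1 Y ->
  vapp (schouten X Y) f = vapp X (vapp Y f) - vapp Y (vapp X f).
Proof.
move=> gY; move: f; apply: derivation_ext => [||i].
- exact: vapp_derivation.
- by apply: derivation_commutator; apply: vapp_derivation.
by rewrite !vappX schouten_vectorE.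
Qed.

Lemma wedge_bivectorr R Q C : graded 2 Q -> #|C| = 2 ->
  wedge R Q C = R set0 * Q C.
Proof.
move=> gQ cC; rewrite ffunE (bigD1 set0) ?sub0set //= setD0 inversions0l mul1r.
rewrite big1 ?addr0 // => D /andP[sDC D0]; rewrite gQ ?mulr0 //.
rewrite cardsD (setIidPr sDC) cC.
by rewrite neq_ltn ltn_subrL lt0n cards_eq0 D0.
Qed.

#[local] Opaque pbracket.

Lemma mvcoef_schouten X R i j : graded 2 R ->
  mvcoef (schouten X R) i j =
  vapp X (mvcoef R i j) - pbracket R (X [set i]) 'X_j - pbracket R 'X_i (X [set j]).
Proof.
move=> gR.
have lt_case (k l : 'I_n) : (k < l)%N ->
    mvcoef (schouten X R) k l = vapp X (mvcoef R k l)
    - pbracket R (X [set k]) 'X_l - pbracket R 'X_k (X [set l]).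
  move=> kl; have nkl : k != l by rewrite neq_ltn kl.
  rewrite [in LHS]/mvcoef (negPf nkl) ltnNge ltnW //= mul1r schoutenE.
  have -> : pbracket R (X [set k]) 'X_l = \sum_a mvcoef R a l * (X [set k])^`M(a).
    rewrite pbracketC pbracketXE -sumrN.
    by apply: eq_bigr => a _; rewrite mvcoefC mulNr opprK.
  have -> : pbracket R 'X_k (X [set l]) = \sum_a mvcoef R k a * (X [set l])^`M(a).
    exact: pbracketXE.
  rewrite vappE -!sumrB; apply: eq_bigr => a _.
  rewrite wedge_bivectorr ?cards2 ?nkl //; last exact: graded_deriv.
  rewrite (wedge_vectorr _ _ (graded_lcontract _ gR)).
  rewrite big_setU1 ?inE //= big_set1 setD2l // setD2r // !inversions11 kl.
  rewrite ltnNge ltnW //= !mvcoef_lcontract [in X in X - _]/rcontract ffunE inE.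
  rewrite inversions0l setU0 (_ : mvcoef R k l = R [set k; l]); last first.
    by rewrite /mvcoef (negPf nkl) ltnNge ltnW //= mul1r.
  rewrite [mv_deriv a R _]ffunE ![mv_deriv a X _]ffunE [mvcoef R a k]mvcoefC.
  by rewrite expr1 expr0; ring.
case: (ltngtP i j) => [|ji|/val_inj->]; first exact: lt_case.
  rewrite mvcoefC lt_case // [mvcoef R i j]mvcoefC raddfN /=.
  have swap (u v w : A) : - (u - v - w) = - u - - w - - v by ring.
  by rewrite (pbracketC R (X [set i]) 'X_j) (pbracketC R 'X_i (X [set j])) swap.
rewrite (pbracketC R 'X_j) /mvcoef eqxx raddf0; ring.
Qed.

(** Both sides are biderivations in (g, f), so the formula for pairs of coordinates
    is enough. *)
Lemma pbracket_schouten X R g f : graded 2 R ->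
  pbracket (schouten X R) g f =
  vapp X (pbracket R g f) - pbracket R (vapp X g) f - pbracket R g (vapp X f).
Proof.
move=> gR; move: g; apply: derivation_ext => [||i].
- exact: pbracket_derivationl.
- apply: derivationB; last exact: pbracket_derivationl.
  apply: (@derivation_commutator _ _ (vapp X) (fun g => pbracket R g f)).
    exact: vapp_derivation.
  exact: pbracket_derivationl.
rewrite [RHS]addrAC; move: f; apply: derivation_ext => [||j].
- exact: pbracket_derivationr.
- apply: derivationB; last exact: pbracket_derivationr.
  apply: (@derivation_commutator _ _ (vapp X) (pbracket R 'X_i)).
    exact: vapp_derivation.
  exact: pbracket_derivationr.
by rewrite (vappX X i) (vappX X j) !pbracketXX (mvcoef_schouten _ _ _ gR) [LHS]addrAC.
Qed.

End Coordinates.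

#[local] Opaque pbracket.

(** * Trivectors, and Lie-Poisson structures *)

Section Trivectors.

Variables (K : fieldType) (n : nat).
Local Notation A := {mpoly K[n]}.
Implicit Types (R V : mvfield K n) (f g h : A) (i j k l : 'I_n).
Implicit Types B C D : {set 'I_n}.

(** Turns signs of shuffles into sums that split along unions. *)
Lemma inversionsE B C :
  inversions B C = (\sum_(i in B) \sum_(j in C) (j < i))%N.
Proof.
rewrite /inversions -sum1_card pair_big_dep /= big_mkcond [RHS]big_mkcond /=.
apply: eq_bigr => -[i j] _; rewrite inE /=.
by case: (i \in B) => //=; case: (j \in C) => //=; case: ltnP.
Qed.

Lemma mvcoef_lt R i j : (i < j)%N -> mvcoef R i j = R [set i; j].
Proof.
move=> ij; rewrite /mvcoef ifN ?mul1r; last by rewrite neq_ltn ij.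
by rewrite ltnNge ltnW ?mul1r.
Qed.

Section Triple.

Variables i j k : 'I_n.
Hypotheses (ij : (i < j)%N) (jk : (j < k)%N).

Let ik : (i < k)%N := ltn_trans ij jk.

Let tripleD : [/\ (i |: [set j; k]) :\ i = [set j; k],
  (i |: [set j; k]) :\ j = [set i; k] & (i |: [set j; k]) :\ k = [set i; j]].
Proof.
have nij : i != j by rewrite neq_ltn ij.
have njk : j != k by rewrite neq_ltn jk.
have nik : i != k by rewrite neq_ltn ik.
split; apply/setP=> a; rewrite !inE.
- by case: eqVneq => //= ->; rewrite (negPf nij) (negPf nik).
- by case: (eqVneq a j) => //= ->; rewrite eq_sym (negPf nij) (negPf njk).
case: (eqVneq a k) => [->|]; rewrite /= ?orbF //.
by rewrite ![k == _]eq_sym (negPf nik) (negPf njk).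
Qed.

Lemma big_triple (F : 'I_n -> A) :
  \sum_(a in i |: [set j; k]) F a = F i + F j + F k.
Proof.
have nij : i != j by rewrite neq_ltn ij.
have njk : j != k by rewrite neq_ltn jk.
have nik : i != k by rewrite neq_ltn ik.
rewrite big_setU1 ?inE ?negb_or ?nij //= big_setU1 ?inE //= big_set1.
by rewrite addrA.
Qed.

Lemma wedge_vectorl3 V R : graded 1 V ->
  wedge V R (i |: [set j; k]) =
  V [set i] * mvcoef R j k + V [set j] * mvcoef R k i + V [set k] * mvcoef R i j.
Proof.
move=> gV; have [Di Dj Dk] := tripleD.
rewrite wedge_vectorl // big_triple Di Dj Dk !inversionsE !big_set1.
have nij : i != j by rewrite neq_ltn ij.
have njk : j != k by rewrite neq_ltn jk.
have nik : i != k by rewrite neq_ltn ik.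
rewrite !big_setU1 ?inE //= !big_set1 ij jk ik.
rewrite ![(_ < i)%N]ltnNge [(k < j)%N]ltnNge (ltnW ij) (ltnW ik) (ltnW jk) /=.
rewrite !addn0 !addn1 [mvcoef R k i]mvcoefC !mvcoef_lt //; ring.
Qed.

Lemma wedge_vectorr3 V R : graded 1 V ->
  wedge R V (i |: [set j; k]) =
  V [set i] * mvcoef R j k + V [set j] * mvcoef R k i + V [set k] * mvcoef R i j.
Proof.
move=> gV; have [Di Dj Dk] := tripleD.
rewrite wedge_vectorr // big_triple Di Dj Dk !inversionsE.
have nij : i != j by rewrite neq_ltn ij.
have njk : j != k by rewrite neq_ltn jk.
have nik : i != k by rewrite neq_ltn ik.
rewrite !big_setU1 ?inE //= !big_set1 ij jk ik.
rewrite ![(_ < i)%N]ltnNge [(k < j)%N]ltnNge (ltnW ij) (ltnW ik) (ltnW jk) /=.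
rewrite !addn0 !add0n !addn1 [mvcoef R k i]mvcoefC !mvcoef_lt //; ring.
Qed.

(** Half of a coefficient of [R, R]. *)
Definition jacobiator R : A :=
  pbracket R 'X_i (mvcoef R j k) + pbracket R 'X_j (mvcoef R k i)
  + pbracket R 'X_k (mvcoef R i j).

(** The two halves of the Schouten bracket are equal: left and right contractions of a
    bivector are opposite, and a vector field commutes with a bivector. *)
Lemma schouten_jacobiator R : graded 2 R ->
  schouten R R (i |: [set j; k]) = 2 * jacobiator R.
Proof.
move=> gR.
rewrite /jacobiator !pbracketXE -!big_split mulr_sumr schoutenE /=.
apply: eq_bigr => l _.
rewrite (wedge_vectorl3 _ (graded_rcontract _ gR)).
rewrite (wedge_vectorr3 _ (graded_lcontract _ gR)).
have coef_deriv a b : mvcoef (mv_deriv l R) a b = (mvcoef R a b)^`M(l).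
  rewrite /mvcoef; case: eqP => _; first by rewrite mderiv0.
  by rewrite ffunE; case: (b < a)%N; rewrite ?expr1 ?expr0 ?mulN1r ?mul1r ?mderivN.
rewrite !coef_deriv !mvcoef_lcontract !mvcoef_rcontract.
rewrite (mvcoefC R i l) (mvcoefC R j l) (mvcoefC R k l); ring.
Qed.

End Triple.
End Trivectors.

Section LiePoisson.

Variables (K : fieldType) (n : nat) (e : n.-tuple 'M[K]_3).
Hypothesis free_e : free e.

Lemma linear_functionE (a : 'I_n -> K) :
  linear_function e (\sum_i a i *: e`_i) = \sum_i a i *: 'X_i.
Proof. by apply: eq_bigr => i _; rewrite coord_sum_free. Qed.

Lemma graded_lie_poisson : graded 2 (lie_poisson e).
Proof.
apply: graded_sum => i _; apply: graded_sum => j _.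
apply: (@graded_wedge _ _ 0 2); first exact: graded_fun.
by apply: (@graded_wedge _ _ 1 1); apply: graded_partial.
Qed.

Lemma lie_bracketC (B C : 'M[K]_3) : lie_bracket B C = - lie_bracket C B.
Proof. by rewrite /lie_bracket opprB. Qed.

Lemma linear_functionN (B : 'M[K]_3) :
  linear_function e (- B) = - linear_function e B.
Proof.
by rewrite -sumrN; apply: eq_bigr => i _; rewrite linearN scaleNr.
Qed.

Lemma mvcoef_lie_poisson i j :
  mvcoef (lie_poisson e) i j = linear_function e (lie_bracket e`_i e`_j).
Proof.
pose h k l := linear_function e (lie_bracket e`_k e`_l).
have lt_case (k l : 'I_n) : (k < l)%N -> mvcoef (lie_poisson e) k l = h k l.
  move=> kl.
  have term (a b : 'I_n) : (a < b)%N ->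
      mvcoef (wedge (fun_mv (h a b)) (wedge (partial K a) (partial K b))) k l
      = if (a == k) && (b == l) then h a b else 0.
    move=> ab; rewrite -pbracketXX pbracket_fun_wedge.
    rewrite pbracket_wedge; try exact: graded_partial.
    rewrite !vappX !ffunE !(inj_eq set1_inj) ![_ == a]eq_sym ![_ == b]eq_sym.
    rewrite -!natrM !mulnb (_ : (a == l) && (b == k) = false) ?subr0.
      by case: (_ && _); rewrite ?mulr1 ?mulr0.
    by apply/negP=> /andP[/eqP al /eqP bk]; rewrite -bk -al ltnNge ltnW in kl.
  have mvcoef_sum (I : finType) (p : pred I) (F : I -> mvfield K n) :
      mvcoef (\sum_(i | p i) F i) k l = \sum_(i | p i) mvcoef (F i) k l.
    apply: (big_morph (fun R => mvcoef R k l)) => [R Q|]; first exact: mvcoefD.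
    by rewrite mvcoef_lt // ffunE.
  transitivity (\sum_(a : 'I_n) \sum_(b : 'I_n | (a < b)%N)
      if (a == k) && (b == l) then h a b else 0).
    rewrite /lie_poisson mvcoef_sum; apply: eq_bigr => a _.
    by rewrite mvcoef_sum; apply: eq_bigr => b; apply: term.
  rewrite (bigD1 k) //= (bigD1 l) //= !eqxx big1 => [|b /andP[_ /negPf->]] //.
  rewrite addr0 big1 ?addr0 // => a /negPf ak.
  by rewrite big1 // => b _; rewrite ak.
case: (ltngtP i j) => [|ji|/val_inj->]; first exact: lt_case.
  by rewrite mvcoefC lt_case // lie_bracketC linear_functionN.
rewrite /mvcoef eqxx /lie_bracket subrr /linear_function big1 // => a _.
by rewrite linear0 scale0r.
Qed.

End LiePoisson.

(** * Sparse polynomials with integer coefficients *)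

(** A pair (c, w) stands for c times the product of the variables listed in the
    word w.  Words are kept sorted, and terms in lexicographic order without
    zero coefficients, so that homogeneous polynomials have normal forms. *)
Definition zpoly := seq (Z * seq nat).

Section IntegerPolynomials.

Implicit Types (p q : zpoly) (u v w : seq nat) (c d : Z).

Fixpoint lexlt u v : bool :=
  match u, v with
  | i :: u', j :: v' => (i < j)%N || (i == j) && lexlt u' v'
  | [::], _ :: _ => true
  | _, [::] => false
  end.

Fixpoint padd p : zpoly -> zpoly :=
  fix padd_p q := match p, q with
  | [::], _ => q
  | _, [::] => p
  | (c, u) :: p', (d, v) :: q' =>
      if u == v then
        let s := c + d in if s == 0 then padd p' q' else (s, u) :: padd p' q'
      else if lexlt u v then (c, u) :: padd p' q else (d, v) :: padd_p q'
  end.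

(** States the unfolding of the nested fixpoint in terms of [padd] itself. *)
Lemma padd_cons c u p d v q : padd ((c, u) :: p) ((d, v) :: q) =
  if u == v then
    let s := c + d in if s == 0 then padd p q else (s, u) :: padd p q
  else if lexlt u v then (c, u) :: padd p ((d, v) :: q)
  else (d, v) :: padd ((c, u) :: p) q.
Proof. by []. Qed.

Definition psum (m : nat) (F : nat -> zpoly) : zpoly :=
  foldr (fun i => padd (F i)) [::] (iota 0 m).

Definition pmonom c u : zpoly := if c == 0 then [::] else [:: (c, u)].

Definition pvar (i : nat) : zpoly := [:: (1, [:: i])].

Definition pterm_mul c u p : zpoly :=
  [seq (c * t.1, merge leq u t.2) | t <- p].

Definition pmul p q : zpoly :=
  foldr (fun t => padd (pterm_mul t.1 t.2 q)) [::] p.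

Definition popp p : zpoly := [seq (- t.1, t.2) | t <- p].

Definition pderiv (i : nat) p : zpoly :=
  [seq (t.1 * (count_mem i t.2)%:R, rem i t.2) | t <- p & i \in t.2].

Section Evaluation.

Variables (R : comPzRingType) (x : nat -> R).

Definition intZ c : R := (int_of_Z c)%:~R.

HB.instance Definition _ := GRing.RMorphism.copy intZ
  ((fun a : int => a%:~R : R) \o int_of_Z).

Definition peval p : R := \sum_(t <- p) intZ t.1 * \prod_(i <- t.2) x i.

Lemma peval_nil : peval [::] = 0. Proof. exact: big_nil. Qed.

Lemma peval_cons c u p :
  peval ((c, u) :: p) = intZ c * \prod_(i <- u) x i + peval p.
Proof. by rewrite /peval big_cons. Qed.

Lemma peval_add p q : peval (padd p q) = peval p + peval q.
Proof.
elim: p q => [|[c u] p IHp] q.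
  by case: q => [|[d v] q] /=; rewrite !peval_nil add0r.
elim: q => [|[d v] q IHq]; first by rewrite peval_nil addr0.
rewrite padd_cons; case: eqP => [<-|_].
  rewrite /=; case: eqP => [cd0|_]; rewrite ?peval_cons IHp.
    by rewrite addrACA -mulrDl -rmorphD cd0 rmorph0 mul0r add0r.
  by rewrite rmorphD mulrDl addrACA.
case: (lexlt u v); first by rewrite peval_cons IHp [peval (_ :: p)]peval_cons addrA.
by rewrite peval_cons IHq [peval (_ :: q)]peval_cons addrCA.
Qed.

Lemma peval_sum m F : peval (psum m F) = \sum_(i < m) peval (F i).
Proof.
rewrite -(big_mkord xpredT (fun i => peval (F i))) /index_iota subn0 /psum.
elim: (iota 0 m) => [|i s IH] /=; first by rewrite peval_nil big_nil.
by rewrite peval_add big_cons IH.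
Qed.

Lemma peval_monom c u : peval (pmonom c u) = intZ c * \prod_(i <- u) x i.
Proof.
rewrite /pmonom; case: eqP => [->|_]; last by rewrite peval_cons peval_nil addr0.
by rewrite rmorph0 mul0r peval_nil.
Qed.

Lemma peval_var i : peval (pvar i) = x i.
Proof. by rewrite peval_cons peval_nil addr0 rmorph1 mul1r big_seq1. Qed.

Lemma peval_opp p : peval (popp p) = - peval p.
Proof.
rewrite /peval big_map -sumrN; apply: eq_bigr => t _.
by rewrite rmorphN mulNr.
Qed.

Lemma peval_mul p q : peval (pmul p q) = peval p * peval q.
Proof.
elim: p => [|[c u] p IH] /=; first by rewrite peval_nil mul0r.
rewrite peval_add IH peval_cons mulrDl; congr (_ + _).
rewrite /peval big_map mulr_sumr; apply: eq_bigr => t _ /=.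
rewrite rmorphM (perm_big _ (permEl (perm_merge _ _ _))) big_cat /=.
by rewrite mulrACA.
Qed.

(** Each variable other than the i-th is treated as a constant; this covers partial
    derivatives of polynomials with parameters. *)
Lemma peval_deriv (D : R -> R) i p :
  {morph D : f g / f + g} -> D 0 = 0 ->
  (forall f g, D (f * g) = D f * g + f * D g) ->
  (forall c, D (intZ c) = 0) -> (forall j, D (x j) = (j == i)%:R) ->
  D (peval p) = peval (pderiv i p).
Proof.
move=> DD D0 DM Dc Dx.
have D1 : D 1 = 0 by have := Dc 1; rewrite rmorph1.
have Dprod u : D (\prod_(j <- u) x j) =
    (count_mem i u)%:R * \prod_(j <- rem i u) x j.
  elim: u => [|j u IH]; first by rewrite big_nil D1 mul0r.
  rewrite big_cons DM Dx IH /= [rem _ _]/=; case: eqP => [->|_] /=; last first.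
    by rewrite mul0r !add0r big_cons mulrCA.
  case: (boolP (i \in u)) => [iu|/count_memPn->]; last by rewrite mul0r mulr0 addr0.
  rewrite natrD mulrDl (big_rem i iu) mulrCA /=.
  by congr (_ + _); rewrite mulrCA.
elim: p => [|[c u] p IH]; first by rewrite /= peval_nil.
rewrite peval_cons DD DM Dc mul0r add0r Dprod IH /pderiv /=.
case: ifP => [_|/negbT/count_memPn->]; last by rewrite mul0r mulr0 add0r.
by rewrite /= peval_cons rmorphM rmorph_nat mulrA.
Qed.

End Evaluation.
End IntegerPolynomials.

(** * The computation over the integers *)

Definition zmatrix := nat -> nat -> Z.

Definition zbasis (i : nat) : zmatrix := fun k l =>
  let unit a b : Z := ((k == a) && (l == b))%:R in
  match i with
  | 0 => unit 0 1 | 1 => unit 0 2 | 2 => unit 1 0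
  | 3 => unit 1 2 | 4 => unit 2 0 | 5 => unit 2 1
  | 6 => (unit 0 0 - unit 2 2)%R
  | _ => (unit 1 1 - unit 2 2)%R
  end%N.

Definition zsum m (F : nat -> Z) : Z := foldr (fun i => +%R (F i)) 0 (iota 0 m).

Definition zbracket (M N : zmatrix) : zmatrix := fun k l =>
  zsum 3 (fun a => M k a * N a l) - zsum 3 (fun a => N k a * M a l).

Definition zcoord (M : zmatrix) (i : nat) : Z :=
  match i with
  | 0 => M 0 1 | 1 => M 0 2 | 2 => M 1 0 | 3 => M 1 2
  | 4 => M 2 0 | 5 => M 2 1 | 6 => M 0 0 | _ => M 1 1
  end%N.

(** Stores the eight values, so that they are computed only once. *)
Definition tab (T : Type) (d : T) (F : nat -> T) : nat -> T :=
  let t := mkseq F 8 in fun i => nth d t i.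

Definition vfield := nat -> zpoly.
Definition bivect := nat -> nat -> zpoly.

Definition tab1 : vfield -> vfield := tab [::].
Definition tab2 (F : bivect) : bivect :=
  tab (fun _ => [::]) (fun i => tab1 (F i)).

(** Structure constants of sl(3) in the given basis. *)
Definition zP : bivect := tab2 (fun i j =>
  psum 8 (fun k => pmonom (zcoord (zbracket (zbasis i) (zbasis j)) k) [:: k])).

Definition papp (X : vfield) (p : zpoly) : zpoly :=
  psum 8 (fun i => pmul (X i) (pderiv i p)).

Definition pham (R : bivect) (p : zpoly) : vfield := tab1 (fun i =>
  psum 8 (fun j => pmul (R i j) (pderiv j p))).

Definition psub p q := padd p (popp q).

Definition plie (X Y : vfield) : vfield := tab1 (fun i =>
  psub (papp X (Y i)) (papp Y (X i))).

(** Follows the coordinate formula for the Lie derivative of a bivector; row [j] of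
    [RX] holds the brackets of the coordinates with the j-th component of [X]. *)
Definition plieb (X : vfield) (R : bivect) : bivect :=
  let RX := tab (fun _ => [::]) (fun j => pham R (X j)) in
  tab2 (fun i j => padd (psub (papp X (R i j)) (RX j i)) (RX i j)).

(** Variables 0 to 7 are the coordinates x12, x13, x21, x23, x31, x32, y13, y23. *)
Definition zX0_table : seq zpoly :=
  [:: [:: (4, [:: 0; 6]%N); (-2, [:: 0; 7]%N); (-6, [:: 1; 5]%N)];
      [:: (6, [:: 0; 3]%N); (-4, [:: 1; 6]%N); (2, [:: 1; 7]%N)];
      [:: (2, [:: 2; 6]%N); (-4, [:: 2; 7]%N); (6, [:: 3; 4]%N)];
      [:: (-6, [:: 1; 2]%N); (-2, [:: 3; 6]%N); (4, [:: 3; 7]%N)];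
      [:: (-6, [:: 2; 5]%N); (-2, [:: 4; 6]%N); (-2, [:: 4; 7]%N)];
      [:: (6, [:: 0; 4]%N); (2, [:: 5; 6]%N); (2, [:: 5; 7]%N)];
      [:: (-2, [:: 6; 6]%N); (-4, [:: 6; 7]%N); (4, [:: 7; 7]%N)];
      [:: (-4, [:: 6; 6]%N); (4, [:: 6; 7]%N); (2, [:: 7; 7]%N)]].

Definition zX0 : vfield := nth [::] zX0_table.

(** The action of the coordinate [a], with the sign that defines the weight vectors. *)
Definition zact (a : nat) (X : vfield) : vfield :=
  tab1 (fun i => popp (plie (fun j => zP j a) X i)).

Definition zX : seq vfield :=
  let X4 := zact 3 zX0 in let X3 := zact 2 zX0 in let X6 := zact 5 zX0 in
  [:: zX0; zact 0 zX0; zact 1 zX0; X3; X4; zact 4 zX0; X6;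
      zact 0 X6; zact 1 X4; zact 4 X3].

(** Variables 8 to 17 stand for the parameters b_0, ..., b_9. *)
Definition zXb : vfield := tab1 (fun i =>
  psum 10 (fun k => pmul (pvar (8 + k)) (nth (fun _ => [::]) zX k i))).

Definition zkilling (i j : nat) : Z :=
  zsum 8 (fun k => zsum 8 (fun l =>
    zcoord (zbracket (zbasis i) (zbasis k)) l
    * zcoord (zbracket (zbasis j) (zbasis l)) k)).

(** The inverse of the Gram matrix of the Killing form, times 18. *)
Definition zdual (i j : nat) : Z :=
  match i, j with
  | 0, 2 | 2, 0 | 1, 4 | 4, 1 | 3, 5 | 5, 3 => 3
  | 6, 6 | 7, 7 => 2
  | 6, 7 | 7, 6 => -1
  | _, _ => 0
  end.

(** The entries of the generic point of the dual, seen in sl(3) through the Killing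
    form and multiplied by 18. *)
Definition zpoint (k l : nat) : zpoly :=
  psum 8 (fun i => psum 8 (fun j => pmonom (zdual j i * zbasis i k l) [:: j])).

(** Equal to C_2 times the square of 18. *)
Definition zC2 : zpoly :=
  psum 3 (fun k => psum 3 (fun l => pmul (zpoint k l) (zpoint l k))).

(** Equal to C_3 times the cube of 18. *)
Definition zC3 : zpoly :=
  psum 3 (fun k => psum 3 (fun l => psum 3 (fun m =>
    pmul (zpoint k l) (pmul (zpoint l m) (zpoint m k))))).

Definition zP' : bivect := plieb zXb zP.

Definition zF : zpoly := papp zXb zC2.

Definition ztriple (V : vfield) (R : bivect) (i j k : nat) : zpoly :=
  padd (pmul (V i) (R j k)) (padd (pmul (V j) (R k i)) (pmul (V k) (R i j))).

Definition zjacobiator (R : bivect) : nat -> nat -> nat -> zpoly :=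
  let H := tab (fun _ _ => [::]) (fun j =>
    tab (fun _ => [::]) (fun k => pham R (R j k))) in
  fun i j k => padd (H j k i) (padd (H k i j) (H i j k)).

Definition ztriples : seq (nat * nat * nat) :=
  [seq ijk <- [seq (ij, k) | ij <- [seq (i, j) | i <- iota 0 8, j <- iota 0 8],
                             k <- iota 0 8]
     | (ijk.1.1 < ijk.1.2 < ijk.2)%N].

Definition zF_wedge_P : bool :=
  let V := pham zP' zF in let J := zjacobiator zP' in
  all (fun t => let: (i, j, k) := t in
    psub (ztriple V zP i j k) (pmul zC2 (J i j k)) == [::]) ztriples.

(** All coefficients of P'(F) /\ P - C_2 [P', P'] / 2, with the parameters b_i as
    further variables. *)
Lemma zF_wedge_P_true : zF_wedge_P.
Proof. by vm_compute. Qed.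

Lemma zC2_casimir i : (i < 8)%N -> pham zP zC2 i = [::].
Proof. by do 8?[case: i => [|i]; first by vm_compute]. Qed.

Lemma zC3_casimir i : (i < 8)%N -> pham zP zC3 i = [::].
Proof. by do 8?[case: i => [|i]; first by vm_compute]. Qed.

Lemma zXbC3 : papp zXb zC3 = [::].
Proof. by vm_compute. Qed.

(** * Tables of coefficients and the fields that they describe *)

Lemma tabE T (d : T) F i : (i < 8)%N -> tab d F i = F i.
Proof. exact: nth_mkseq. Qed.

Section Interpretation.

Variables (K : fieldType) (b : 'rV[K]_10).
Local Notation A := {mpoly K[8]}.

Definition param_point (i : nat) : A :=
  if insub i is Some j then 'X_j else (b 0 (inord (i - 8)))%:MP.

Local Notation "''[' p ]" := (peval param_point p) (format "''[' p ]").

Lemma param_point_var (i : 'I_8) : param_point i = 'X_i.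
Proof. by rewrite /param_point valK. Qed.

Lemma param_point_b (k : 'I_10) : param_point (8 + k) = (b 0 k)%:MP.
Proof. by rewrite /param_point insubF ?addKn ?inord_val // ltnNge leq_addr. Qed.

Lemma intZ_mpoly c : intZ A c = (intZ K c)%:MP.
Proof. by rewrite /intZ rmorph_int. Qed.

Lemma mderiv_peval (i : 'I_8) p : '[p]^`M(i) = '[pderiv i p].
Proof.
apply: peval_deriv => [f g||f g|c|j].
- exact: mderivD.
- exact: mderiv0.
- exact: mderivM.
- by rewrite intZ_mpoly mderivC.
rewrite /param_point; case: insubP => [k _ <-|].
  by rewrite mderiv_var eq_sym.
by rewrite mderivC -leqNgt; case: eqP => // ->; rewrite leqNgt ltn_ord.
Qed.

Definition vector_table (X : mvfield K 8) (x : vfield) : Prop :=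
  forall i : 'I_8, X [set i] = '[x i].

Definition bivector_table (R : mvfield K 8) (r : bivect) : Prop :=
  forall i j : 'I_8, mvcoef R i j = '[r i j].

Lemma peval_sub p q : '[psub p q] = '[p] - '[q].
Proof. by rewrite peval_add peval_opp. Qed.

Lemma vapp_peval X x p : vector_table X x -> vapp X '[p] = '[papp x p].
Proof.
move=> Xx; rewrite vappE peval_sum; apply: eq_bigr => i _.
by rewrite peval_mul Xx mderiv_peval.
Qed.

Lemma pbracket_peval R r (i : 'I_8) p :
  bivector_table R r -> pbracket R 'X_i '[p] = '[pham r p i].
Proof.
move=> Rr; rewrite pbracketXE /pham /tab1 tabE // peval_sum.
by apply: eq_bigr => j _; rewrite peval_mul Rr mderiv_peval.
Qed.

Lemma vector_table_tab X x : vector_table X x -> vector_table X (tab1 x).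
Proof. by move=> Xx i; rewrite /tab1 tabE. Qed.

Lemma bivector_table_tab R r : bivector_table R r -> bivector_table R (tab2 r).
Proof. by move=> Rr i j; rewrite /tab2 /tab1 !tabE. Qed.

Lemma vector_table_lie X Y x y : graded 1 Y ->
  vector_table X x -> vector_table Y y -> vector_table (schouten X Y) (plie x y).
Proof.
move=> gY Xx Yy; apply: vector_table_tab => i.
by rewrite peval_sub schouten_vectorE // Xx Yy (vapp_peval _ Xx) (vapp_peval _ Yy).
Qed.

Lemma bivector_table_lie X R x r : graded 2 R ->
  vector_table X x -> bivector_table R r -> bivector_table (schouten X R) (plieb x r).
Proof.
move=> gR Xx Rr; apply: bivector_table_tab => i j.
rewrite peval_add peval_sub mvcoef_schouten // !tabE // Rr (vapp_peval _ Xx).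
rewrite pbracketC !Xx !(pbracket_peval _ _ Rr); ring.
Qed.

Lemma peval_triple R r S s p (i j k : 'I_8) :
  bivector_table R r -> bivector_table S s ->
  '[ztriple (pham r p) s i j k] =
  pbracket R 'X_i '[p] * mvcoef S j k + pbracket R 'X_j '[p] * mvcoef S k i
  + pbracket R 'X_k '[p] * mvcoef S i j.
Proof.
move=> Rr Ss; rewrite !peval_add !peval_mul addrA.
by rewrite -!(pbracket_peval _ _ Rr) -!Ss.
Qed.

Lemma peval_jacobiator R r (i j k : 'I_8) : bivector_table R r ->
  '[zjacobiator r i j k] = jacobiator i j k R.
Proof.
move=> Rr; rewrite /zjacobiator !tabE // !peval_add addrA.
by rewrite -!(pbracket_peval _ _ Rr) -!Rr.
Qed.

End Interpretation.

(** * Bases of sl(3) and gl(3) *)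

Lemma intZ_sum (R : comPzRingType) m F :
  intZ R (zsum m F) = \sum_(i < m) intZ R (F i).
Proof.
rewrite -(big_mkord xpredT (fun i => intZ R (F i))) /index_iota subn0 /zsum.
elim: (iota 0 m) => [|i s IH] /=; first by rewrite rmorph0 big_nil.
by rewrite rmorphD big_cons /= IH.
Qed.

Section Bases.

Variable K : fieldType.
Hypothesis char0 : forall m, (m%:R == 0 :> K) = (m == 0%N).
Variables (c : K) (c_neq0 : c != 0).

Definition zmx (M : zmatrix) : 'M[K]_3 := \matrix_(k, l) intZ K (M k l).

(** Makes the coordinates of a traceless matrix readable from its entries. *)
Lemma sl3_combE (a : nat -> K) :
  \sum_(i < 8) a i *: (sl3_basis K)`_i =
  \matrix_(k, l) nth 0 (nth [::] [:: [:: a 6%N; a 0%N; a 1%N];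
                                     [:: a 2%N; a 7%N; a 3%N];
                                     [:: a 4%N; a 5%N; - a 6%N - a 7%N]] k) l.
Proof.
apply/matrixP=> k l; rewrite summxE !big_ord_recl big_ord0 !mxE.
by case: k => -[|[|[|//]]] ?; case: l => -[|[|[|//]]] ? /=;
  rewrite ?(mulr0, mulr1, addr0, add0r, subr0, sub0r, oppr0, mulrN).
Qed.

Lemma sl3_basisE (i : 'I_8) : (sl3_basis K)`_i = zmx (zbasis i).
Proof.
apply/matrixP=> k l; rewrite mxE.
by case: i => -[|[|[|[|[|[|[|[|//]]]]]]]] ?; rewrite !mxE;
  case: k => -[|[|[|//]]] ?; case: l => -[|[|[|//]]] ? /=;
  rewrite ?rmorphB ?rmorph_nat.
Qed.

Definition mxcoord (M : 'M[K]_3) (i : nat) : K :=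
  let a k l := M (inord k) (inord l) in
  match i with
  | 0 => a 0 1 | 1 => a 0 2 | 2 => a 1 0 | 3 => a 1 2
  | 4 => a 2 0 | 5 => a 2 1 | 6 => a 0 0 | _ => a 1 1
  end%N.

Lemma traceless_comb (M : 'M[K]_3) : \tr M = 0 ->
  \sum_(i < 8) mxcoord M i *: (sl3_basis K)`_i = M.
Proof.
move=> trM; rewrite sl3_combE; apply/matrixP=> k l; rewrite mxE /mxcoord.
have inordE (m : nat) (i : 'I_3) : m = i -> inord m = i by move=> ->; rewrite inord_val.
case: k => -[|[|[|//]]] kP; case: l => -[|[|[|//]]] lP /=;
  try by congr (M _ _); apply: inordE.
rewrite !(inordE 0%N ord0) // !(inordE 1%N (lift ord0 ord0)) //.
rewrite -opprD; apply/eqP; rewrite eq_sym -addr_eq0 addrC; apply/eqP.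
rewrite -[RHS]trM /mxtrace !big_ord_recl big_ord0 addr0 addrA.
by congr (_ + _ + M _ _); apply/val_inj.
Qed.

Lemma zcoordE M i : mxcoord (zmx M) i = intZ K (zcoord M i).
Proof. by case: i => [|[|[|[|[|[|[|i]]]]]]] /=; rewrite mxE !inordK. Qed.

Lemma lie_bracket_zmx M N : lie_bracket (zmx M) (zmx N) = zmx (zbracket M N).
Proof.
apply/matrixP=> k l; rewrite !mxE rmorphB /= !intZ_sum; congr (_ - _);
  by apply: eq_bigr => a _; rewrite !mxE rmorphM.
Qed.

Lemma lie_bracket_trace (M N : 'M[K]_3) : \tr (lie_bracket M N) = 0.
Proof. by rewrite /lie_bracket raddfB /= mxtrace_mulC subrr. Qed.

Lemma gl3_basis_widen (i : 'I_8) :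
  (gl3_basis c)`_(widen_ord (leqnSn 8) i) = (sl3_basis K)`_i.
Proof. by rewrite nth_rcons /= ltn_ord. Qed.

Lemma gl3_basis_max : (gl3_basis c)`_(@ord_max 8) = c%:M.
Proof. by rewrite nth_rcons. Qed.

(** The trace of a vanishing combination is 3 c times its coefficient on the scalar
    matrix, which therefore vanishes outside characteristic 3. *)
Lemma free_gl3 : free (gl3_basis c).
Proof.
apply/freeP=> a; rewrite big_ord_recr gl3_basis_max -[X in X = 0]/(_ + _).
under eq_bigr do rewrite gl3_basis_widen.
pose a' k := a (inord k).
have aa' (i : 'I_8) : a (widen_ord (leqnSn 8) i) = a' i.
  by congr (a _); apply/val_inj; rewrite /= inordK // ltnW // ltnS.
under eq_bigr do rewrite aa'.
move=> e0.
have {e0} e : (\sum_(i < 8) a' i *: (sl3_basis K)`_i) = (- (a ord_max * c))%:M.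
  by apply/eqP; rewrite raddfN /= -addr_eq0 -scale_scalar_mx; apply/eqP.
have {}e (k l : 'I_3) :=
  congr1 (fun M : 'M[K]_3 => M k l) (etrans (esym (sl3_combE a')) e).
pose o k (kP : (k < 3)%N) := Ordinal kP.
have e6 := e (o 0%N isT) (o 0%N isT); rewrite !mxE /= mulr1n in e6.
have e7 := e (o 1%N isT) (o 1%N isT); rewrite !mxE /= mulr1n in e7.
have e8 := e (o 2%N isT) (o 2%N isT); rewrite !mxE /= mulr1n e6 e7 opprK in e8.
have a8 : a ord_max = 0.
  have : a ord_max * c * 3%:R = 0.
    by rewrite mulr_natr mulrSr mulr2n e8 addNr.
  by move/eqP; rewrite !mulf_eq0 char0 (negPf c_neq0) !orbF => /eqP.
have a'0 k : (k < 8)%N -> a' k = 0.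
  move: e6 e7; rewrite a8 mul0r oppr0 => e6 e7.
  have e01 := e (o 0%N isT) (o 1%N isT); rewrite !mxE /= mulr0n in e01.
  have e02 := e (o 0%N isT) (o 2%N isT); rewrite !mxE /= mulr0n in e02.
  have e10 := e (o 1%N isT) (o 0%N isT); rewrite !mxE /= mulr0n in e10.
  have e12 := e (o 1%N isT) (o 2%N isT); rewrite !mxE /= mulr0n in e12.
  have e20 := e (o 2%N isT) (o 0%N isT); rewrite !mxE /= mulr0n in e20.
  have e21 := e (o 2%N isT) (o 1%N isT); rewrite !mxE /= mulr0n in e21.
  by do 8?[case: k => [|k] //].
move=> i; case: (ltnP i 8) => [i8|i8].
  by rewrite -[a i]/(a i) -(a'0 i i8) /a' inord_val.
by rewrite -a8; congr (a _); apply/val_inj/eqP; rewrite eqn_leq i8 -ltnS ltn_ord.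
Qed.

Lemma free_sl3 : free (sl3_basis K).
Proof.
apply: (@catl_free _ _ [:: c%:M]).
rewrite (_ : _ ++ _ = gl3_basis c); first exact: free_gl3.
by rewrite cats1.
Qed.

Lemma coord_traceless (M : 'M[K]_3) (i : 'I_8) : \tr M = 0 ->
  coord (sl3_basis K) i M = mxcoord M i.
Proof. by move=> /traceless_comb {1}<-; rewrite coord_sum_free // free_sl3. Qed.

(** The coordinate of a traceless matrix along the scalar matrix is zero. *)
Lemma linear_function_gl3 (M : 'M[K]_3) : \tr M = 0 ->
  linear_function (gl3_basis c) M = mwiden (linear_function (sl3_basis K) M).
Proof.
move=> /traceless_comb M_comb.
rewrite -[in RHS]M_comb linear_functionE ?free_sl3 // raddf_sum /=.
pose a (i : 'I_9) := if (i < 8)%N then mxcoord M i else 0.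
have aE : \sum_(i < 9) a i *: (gl3_basis c)`_i = M.
  rewrite big_ord_recr /= {2}/a /= scale0r addr0 -[RHS]M_comb.
  by apply: eq_bigr => i _; rewrite gl3_basis_widen /a /= ltn_ord.
rewrite -[X in linear_function (gl3_basis c) X]aE.
rewrite linear_functionE ?free_gl3 // big_ord_recr /= {2}/a /= scale0r addr0.
apply: eq_bigr => i _; rewrite /a /= ltn_ord mwidenZ; congr (_ *: _).
by rewrite mwidenX mnmwiden1.
Qed.

End Bases.

(** * The objects on the dual of sl(3), described by tables *)

Section Specs.

Variable K : fieldType.
Hypothesis char0 : forall m, (m%:R == 0 :> K) = (m == 0%N).
Variable b : 'rV[K]_10.
Local Notation "''[' p ]" := (peval (param_point b) p) (format "''[' p ]").

Let free_sl3 : free (sl3_basis K) := free_sl3 char0 (oner_neq0 K).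

Lemma coord_bracket (i j k : 'I_8) :
  coord (sl3_basis K) k (lie_bracket (sl3_basis K)`_i (sl3_basis K)`_j) =
  intZ K (zcoord (zbracket (zbasis i) (zbasis j)) k).
Proof.
rewrite (coord_traceless char0 (oner_neq0 K)) ?lie_bracket_trace //.
by rewrite !sl3_basisE lie_bracket_zmx zcoordE.
Qed.

Lemma peval_monom1 c i : '[pmonom c [:: i]] = intZ K c *: param_point b i.
Proof. by rewrite peval_monom big_seq1 intZ_mpoly mul_mpolyC. Qed.

Lemma graded_P : graded 2 (P K).
Proof. exact: graded_lie_poisson. Qed.

Lemma bivector_table_P : bivector_table b (P K) zP.
Proof.
apply: bivector_table_tab => i j; rewrite mvcoef_lie_poisson peval_sum.
by apply: eq_bigr => k _; rewrite coord_bracket peval_monom1 param_point_var.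
Qed.

Lemma graded_X0 : graded 1 (X0 K).
Proof.
have gd f i : graded 1 (wedge (fun_mv f) (partial K i)).
  by apply: (@graded_wedge _ _ 0 1); [apply: graded_fun | apply: graded_partial].
by do 7?[apply: gradedD]; apply: gd.
Qed.

Lemma vector_table_X0 : vector_table b (X0 K) zX0.
Proof.
have mvD (R Q : mvfield K 8) C : (R + Q) C = R C + Q C by rewrite ffunE.
move=> i; rewrite /X0 !mvD !wedge_funl !ffunE !(inj_eq set1_inj).
have xE := (param_point_var b i12 : param_point b 0 = x12 K,
            param_point_var b i13 : param_point b 1 = x13 K,
            param_point_var b i21 : param_point b 2 = x21 K,
            param_point_var b i23 : param_point b 3 = x23 K,
            param_point_var b i31 : param_point b 4 = x31 K,
            param_point_var b i32 : param_point b 5 = x32 K,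
            param_point_var b j13 : param_point b 6 = y13 K,
            param_point_var b j23 : param_point b 7 = y23 K).
case: i => -[|[|[|[|[|[|[|[|//]]]]]]]] iP; rewrite /zX0 /= !peval_cons peval_nil;
  rewrite !big_cons !big_nil ?rmorphN !rmorph_nat !xE; ring.
Qed.

Lemma graded_act (a : 'I_8) X : graded 1 X -> graded 1 (- schouten (ham (P K) 'X_a) X).
Proof.
move=> gX; apply: gradedN; apply: (@graded_schouten _ _ 0 0) => //.
by apply: graded_ham; apply: graded_P.
Qed.

Lemma vector_table_act (a : 'I_8) X x : graded 1 X ->
  vector_table b X x -> vector_table b (- schouten (ham (P K) 'X_a) X) (zact a x).
Proof.
move=> gX Xx; apply: vector_table_tab => i; rewrite ffunE peval_opp.
congr (- _); apply: vector_table_lie => // j.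
by rewrite ham_var bivector_table_P.
Qed.

(** The ten weight vectors are obtained from the first one by the actions of
    coordinates, which tables follow. *)
Lemma vector_table_Xb : graded 1 (Xb b) /\ vector_table b (Xb b) zXb.
Proof.
pose spec X x := graded 1 X /\ vector_table b X x.
have act (a : 'I_8) X x : spec X x ->
    spec (- schouten (ham (P K) 'X_a) X) (zact a x).
  by case=> gX Xx; split; [apply: graded_act | apply: vector_table_act].
have s0 : spec (X0 K) zX0 by split; [apply: graded_X0 | apply: vector_table_X0].
have sX (k : 'I_10) : spec
    [:: X0 K; X1 K; X2 K; X3 K; X4 K; X5 K; X6 K; X7 K; X8 K; X9 K]`_k
    (nth (fun _ => [::]) zX k).
  case: k => -[|[|[|[|[|[|[|[|[|[|//]]]]]]]]]] kP.
  - exact: s0.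
  - exact: (act i12 _ _ s0).
  - exact: (act i13 _ _ s0).
  - exact: (act i21 _ _ s0).
  - exact: (act i23 _ _ s0).
  - exact: (act i31 _ _ s0).
  - exact: (act i32 _ _ s0).
  - exact: (act i12 _ _ (act i32 _ _ s0)).
  - exact: (act i13 _ _ (act i23 _ _ s0)).
  - exact: (act i31 _ _ (act i21 _ _ s0)).
split; first by apply: graded_sum => k _; apply: gradedZ; case: (sX k).
apply: vector_table_tab => i; rewrite sum_ffunE peval_sum; apply: eq_bigr => k _.
rewrite ffunE peval_mul peval_var param_point_b mul_mpolyC; congr (_ *: _).
by case: (sX k).
Qed.

Lemma killing_mxE : killing_mx (sl3_basis K) =
  \matrix_(i, j) intZ K (zkilling i j).
Proof.
apply/matrixP=> i j; rewrite !mxE /killing /mxtrace intZ_sum.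
apply: eq_bigr => k _; rewrite mxE intZ_sum; apply: eq_bigr => l _.
by rewrite !mxE !coord_bracket rmorphM.
Qed.

Lemma zdualE (i j : 'I_8) :
  zsum 8 (fun k => zkilling i k * zdual k j) = 18 *+ (i == j).
Proof.
by apply/eqP; case: i => -[|[|[|[|[|[|[|[|//]]]]]]]] ?;
  case: j => -[|[|[|[|[|[|[|[|//]]]]]]]] ?; vm_compute.
Qed.

Lemma invmx_killing : invmx (killing_mx (sl3_basis K)) =
  18^-1 *: \matrix_(i, j) intZ K (zdual i j).
Proof.
have n18 : (18 : K) != 0 by rewrite char0.
have KN : killing_mx (sl3_basis K) *m
    (18^-1 *: \matrix_(i, j) intZ K (zdual i j)) = 1%:M.
  rewrite killing_mxE -scalemxAr; apply/matrixP=> i j; rewrite !mxE.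
  rewrite (eq_bigr (fun k : 'I_8 => intZ K (zkilling i k * zdual k j))); last first.
    by move=> k _; rewrite !mxE rmorphM.
  rewrite -(intZ_sum _ _ (fun k => zkilling i k * zdual k j)) zdualE.
  rewrite rmorphMn rmorph_nat.
  by rewrite mulrnAr mulVf.
have [uK _] := mulmx1_unit KN.
by rewrite -[LHS]mulmx1 -KN mulKmx.
Qed.

Lemma killing_pointE : killing_point (sl3_basis K) =
  18^-1%:MP *: \matrix_(k, l) '[zpoint k l].
Proof.
apply/matrixP=> k l; rewrite summxE !mxE peval_sum mulr_sumr.
apply: eq_bigr => i _; rewrite !mxE peval_sum mulr_suml mulr_sumr.
apply: eq_bigr => j _; rewrite peval_monom1 param_point_var invmx_killing !mxE.
rewrite sl3_basisE mxE rmorphM /= -!mul_mpolyC !mpolyCM; ring.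
Qed.

Lemma C2E : C2 K = (18^-1 ^+ 2)%:MP * '[zC2].
Proof.
rewrite /C2 killing_pointE expr2 -[_ * _]/(_ *m _) -scalemxAl -scalemxAr scalerA.
rewrite mxtraceZ -mpolyCM -expr2; congr (_ * _).
rewrite peval_sum; apply: eq_bigr => k _; rewrite mxE peval_sum.
by apply: eq_bigr => l _; rewrite !mxE peval_mul.
Qed.

Lemma C3E : C3 K = (18^-1 ^+ 3)%:MP * '[zC3].
Proof.
rewrite /C3 killing_pointE exprS expr2 -![_ * _]/(_ *m _).
rewrite -!(scalemxAl, scalemxAr) !scalerA.
rewrite mxtraceZ -!mpolyCM -expr2 -exprS; congr (_ * _).
rewrite peval_sum; apply: eq_bigr => k _; rewrite mxE peval_sum.
apply: eq_bigr => l _; rewrite !mxE peval_sum mulr_sumr.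
by apply: eq_bigr => n _; rewrite !mxE !peval_mul.
Qed.

End Specs.

(** * The identity behind the involution *)

Section Key.

Variable K : fieldType.
Hypothesis char0 : forall m, (m%:R == 0 :> K) = (m == 0%N).
Variable b : 'rV[K]_10.
Local Notation A := {mpoly K[8]}.
Local Notation "''[' p ]" := (peval (param_point b) p) (format "''[' p ]").

(** Injectivity of the wedge product with P on vector fields.  For i, j, l distinct,
    x_il and x_lj commute with x_ij and have bracket x_ij or - x_ij, so the
    component of V /\ P on these three coordinates is V(x_ij) x_ij up to sign.  Once
    all V(x_ij) vanish, the component on y, x_12 and x_21 gives V(y) {x_12, x_21}. *)
Lemma wedge_P_inj (V : 'I_8 -> A) :
  (forall i j k : 'I_8, (i < j)%N -> (j < k)%N ->
    V i * mvcoef (P K) j k + V j * mvcoef (P K) k i + V k * mvcoef (P K) i j = 0) ->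
  forall i, V i = 0.
Proof.
move=> VP.
have {}VP (i j k : 'I_8) : (i < j)%N -> (j < k)%N ->
    V i * '[zP j k] + V j * '[zP k i] + V k * '[zP i j] = 0.
  by move=> ij jk; rewrite -!(bivector_table_P char0 b); apply: VP.
have X_neq0 (i : 'I_8) : ('X_i : A) != 0.
  by apply/eqP=> /(congr1 (mderiv i))/eqP; rewrite mderiv_var eqxx mderiv0 oner_eq0.
have V0 i (p : zpoly) : V i * '[p] = 0 -> '[p] != 0 -> V i = 0.
  by move=> /eqP; rewrite mulf_eq0 => /orP[/eqP//|/eqP->]; rewrite eqxx.
have var_neq0 (i : 'I_8) : '[pvar i] != 0 by rewrite peval_var param_point_var.
have opp_neq0 (i : 'I_8) : '[popp (pvar i)] != 0 by rewrite peval_opp oppr_eq0.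
have simp := (peval_nil, mulr0, addr0, add0r).
have V12 : V i12 = 0.
  have := VP i12 i13 i32 isT isT.
  rewrite (_ : zP i13 i32 = pvar i12) // (_ : zP i32 i12 = [::]) //.
  rewrite (_ : zP i12 i13 = [::]) // !simp => h; exact: V0 h (var_neq0 _).
have V13 : V i13 = 0.
  have := VP i12 i13 i23 isT isT.
  rewrite (_ : zP i13 i23 = [::]) // (_ : zP i23 i12 = popp (pvar i13)) //.
  rewrite (_ : zP i12 i13 = [::]) // !simp => h; exact: V0 h (opp_neq0 _).
have V21 : V i21 = 0.
  have := VP i21 i23 i31 isT isT.
  rewrite (_ : zP i23 i31 = pvar i21) // (_ : zP i31 i21 = [::]) //.
  rewrite (_ : zP i21 i23 = [::]) // !simp => h; exact: V0 h (var_neq0 _).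
have V23 : V i23 = 0.
  have := VP i13 i21 i23 isT isT.
  rewrite (_ : zP i21 i23 = [::]) // (_ : zP i23 i13 = [::]) //.
  rewrite (_ : zP i13 i21 = popp (pvar i23)) // !simp => h; exact: V0 h (opp_neq0 _).
have V31 : V i31 = 0.
  have := VP i21 i31 i32 isT isT.
  rewrite (_ : zP i31 i32 = [::]) // (_ : zP i32 i21 = pvar i31) //.
  rewrite (_ : zP i21 i31 = [::]) // !simp => h; exact: V0 h (var_neq0 _).
have V32 : V i32 = 0.
  have := VP i12 i31 i32 isT isT.
  rewrite (_ : zP i31 i32 = [::]) // (_ : zP i32 i12 = [::]) //.
  rewrite (_ : zP i12 i31 = popp (pvar i32)) // !simp => h; exact: V0 h (opp_neq0 _).
have diff_neq0 : '[zP i12 i21] != 0.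
  rewrite (_ : zP i12 i21 = psub (pvar j13) (pvar j23)) // peval_sub !peval_var.
  rewrite !param_point_var; apply/eqP => /(congr1 (mderiv j13))/eqP.
  by rewrite mderivB !mderiv_var mderiv0 subr0 oner_eq0.
have Vy13 : V j13 = 0.
  have := VP i12 i21 j13 isT isT; rewrite V12 V21 !mul0r !add0r => h.
  exact: V0 h diff_neq0.
have Vy23 : V j23 = 0.
  have := VP i12 i21 j23 isT isT; rewrite V12 V21 !mul0r !add0r => h.
  exact: V0 h diff_neq0.
by case=> -[|[|[|[|[|[|[|[|//]]]]]]]] iP; rewrite (bool_irrelevance iP isT).
Qed.

#[local] Opaque zP zC2 zC3 zXb zF zP' ztriples pham papp ztriple zjacobiator.

Lemma C2_casimir g : pbracket (P K) g (C2 K) = 0.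
Proof.
rewrite pbracketEl big1 // => i _; rewrite (C2E char0 b) mul_mpolyC linearZ /=.
rewrite (pbracket_peval _ _ (bivector_table_P char0 b)).
by rewrite zC2_casimir // peval_nil scaler0 mul0r.
Qed.

Lemma C3_casimir g : pbracket (P K) g (C3 K) = 0.
Proof.
rewrite pbracketEl big1 // => i _; rewrite (C3E char0 b) mul_mpolyC linearZ /=.
rewrite (pbracket_peval _ _ (bivector_table_P char0 b)).
by rewrite zC3_casimir // peval_nil scaler0 mul0r.
Qed.

(** By equivariance the quartic polynomials X_b C_3 form a quotient of W*, and W* does
    not occur among quartic polynomials. *)
Lemma Xb_C3 : vapp (Xb b) (C3 K) = 0.
Proof.
have [_ Xx] := vector_table_Xb char0 b.
rewrite (C3E char0 b) mul_mpolyC linearZ /= (vapp_peval _ Xx) zXbC3 peval_nil.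
by rewrite scaler0.
Qed.

Let P' := schouten (Xb b) (P K).
Let F := vapp (Xb b) (C2 K).

Lemma graded_P' : graded 2 P'.
Proof.
by apply: (@graded_schouten _ _ 0 1); [case: (vector_table_Xb char0 b)|apply: graded_P].
Qed.

Lemma bivector_table_P' : bivector_table b P' zP'.
Proof.
apply: bivector_table_lie; first exact: graded_P.
  by case: (vector_table_Xb char0 b).
exact: bivector_table_P.
Qed.

(** The components of P'(F) /\ P = C_2 [P', P'] / 2; the common scalar 1 / 18 ^ 2 is
    that of C_2. *)
Lemma ham_F_wedge_P (i j k : 'I_8) : (i < j)%N -> (j < k)%N ->
  pbracket P' 'X_i F * mvcoef (P K) j k + pbracket P' 'X_j F * mvcoef (P K) k i
  + pbracket P' 'X_k F * mvcoef (P K) i j = C2 K * jacobiator i j k P'.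
Proof.
move=> ij jk; have [_ Xx] := vector_table_Xb char0 b.
have FE : F = 18^-1 ^+ 2 *: '[zF].
  by rewrite /F (C2E char0 b) mul_mpolyC linearZ /= (vapp_peval _ Xx).
have tP : (i : nat, j : nat, k : nat) \in ztriples.
  rewrite mem_filter; apply/andP; split; first by rewrite /= ij.
  apply: (allpairs_f (fun ij k => (ij, k))); last by rewrite mem_iota /=.
  by apply: (allpairs_f (fun i j => (i, j))); rewrite mem_iota /=.
have /eqP := allP zF_wedge_P_true _ tP.
move/(congr1 (peval (param_point b))); rewrite [RHS]peval_nil peval_sub peval_mul.
rewrite (peval_jacobiator _ _ _ bivector_table_P').
rewrite (peval_triple _ _ _ _ bivector_table_P' (bivector_table_P char0 b)).
move/eqP; rewrite subr_eq0 => /eqP key.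
have lin l : pbracket P' 'X_l F = 18^-1 ^+ 2 *: pbracket P' 'X_l '[zF].
  by rewrite FE linearZ.
have scale (s : K) (u v w p q r c d : A) : u * p + v * q + w * r = c * d ->
    (s *: u) * p + (s *: v) * q + (s *: w) * r = (s *: c) * d.
  by move=> e; rewrite -!scalerAl -!scalerDr e.
by rewrite !lin (C2E char0 b) mul_mpolyC; apply: scale.
Qed.

End Key.

(** * Involution on the dual of sl(3) *)

Section InInvolution.

Variables (K : fieldType) (n : nat) (R : mvfield K n).
Hypothesis char0 : forall m, (m%:R == 0 :> K) = (m == 0%N).
Implicit Types f g : {mpoly K[n]}.

Lemma pbracketxx f : pbracket R f f = 0.
Proof.
have /eqP := pbracketC R f f.
by rewrite -addr_eq0 -mulr2n -scaler_nat scaler_eq0 char0 => /eqP.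
Qed.

Lemma in_involution1 f : in_involution R [:: f].
Proof. by move=> g h; rewrite !inE => /eqP-> /eqP->; exact: pbracketxx. Qed.

(** Antisymmetry leaves one bracket to check for each pair. *)
Lemma in_involution_cons f s : {in s, forall g, pbracket R f g = 0} ->
  in_involution R s -> in_involution R (f :: s).
Proof.
move=> fs ss g h; rewrite !inE => /predU1P[->|gs] /predU1P[->|hs].
- exact: pbracketxx.
- exact: fs.
- by rewrite pbracketC fs // oppr0.
- exact: ss.
Qed.

End InInvolution.

Section LenardScheme.

Variables (K : fieldType) (n : nat) (R S : mvfield K n).
Hypothesis char0 : forall m, (m%:R == 0 :> K) = (m == 0%N).
Variables Q F M C D : {mpoly K[n]}.
Hypothesis RC : forall g, pbracket R g C = 0.
Hypothesis RD : forall g, pbracket R g D = 0.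
Hypothesis SQ : forall g, pbracket S g Q = pbracket R g M.
Hypothesis SC : forall g, pbracket S g C = - pbracket R g F.
Hypothesis SF : forall g, pbracket S g F = C * pbracket R g Q.
Hypothesis SD : forall g, pbracket S g D = 0.

Let QF : pbracket R Q F = 0.
Proof. by rewrite -[LHS]opprK -SC pbracketC SQ pbracketC RC !oppr0. Qed.

Let QM : pbracket R Q M = 0.
Proof. by rewrite -SQ pbracketxx. Qed.

Let FM : pbracket R F M = 0.
Proof. by rewrite -SQ pbracketC SF pbracketxx // mulr0 oppr0. Qed.

(** {Q, F}, {Q, M} and {F, M} are the only brackets without a Casimir function; the
    relations trade each of them for a deformed bracket that vanishes. *)
Lemma lenard_involution : in_involution R [:: Q; F; M; C; D].
Proof.
refine (in_involution_cons char0 _ _) => [g|].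
  by rewrite !inE => /or4P[]/eqP->; [exact: QF|exact: QM|exact: RC|exact: RD].
refine (in_involution_cons char0 _ _) => [g|].
  by rewrite !inE => /or3P[]/eqP->; [exact: FM|exact: RC|exact: RD].
refine (in_involution_cons char0 _ _) => [g|].
  by rewrite !inE => /orP[]/eqP->; [exact: RC|exact: RD].
refine (in_involution_cons char0 _ _) => [g|].
  by rewrite inE => /eqP->; exact: RD.
exact: in_involution1.
Qed.

(** The relations express every deformed bracket by an undeformed one of the same
    family. *)
Lemma lenard_involution_deformed : in_involution S [:: Q; F; M; C; D].
Proof.
have inv := lenard_involution.
have inQ : Q \in [:: Q; F; M; C; D] by rewrite !inE eqxx.
have inF : F \in [:: Q; F; M; C; D] by rewrite !inE eqxx orbT.
have inM : M \in [:: Q; F; M; C; D] by rewrite !inE eqxx !orbT.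
refine (in_involution_cons char0 _ _) => [g g_in|].
  rewrite pbracketC SQ inv ?oppr0 // inE; first by rewrite g_in orbT.
refine (in_involution_cons char0 _ _) => [g g_in|].
  rewrite pbracketC SF inv ?mulr0 ?oppr0 // 2!inE; first by rewrite g_in !orbT.
refine (in_involution_cons char0 _ _) => [g|].
  rewrite !inE => /orP[]/eqP->; last exact: SD.
  by rewrite SC inv ?oppr0.
refine (in_involution_cons char0 _ _) => [g|].
  by rewrite inE => /eqP->; exact: SD.
exact: in_involution1.
Qed.

End LenardScheme.

Section Involution.

Variable K : fieldType.
Hypothesis char0 : forall m, (m%:R == 0 :> K) = (m == 0%N).
Variables (b : 'rV[K]_10) (Q m : {mpoly K[8]}).
Hypotheses (hQ : is_Qb b Q) (hm : is_mb b Q m).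

Let P := P K.
Let X := Xb b.
Let P' := schouten X P.
Let F := vapp X (C2 K).
Let M := m - vapp X Q.

Let P'E g f : pbracket P' g f =
  vapp X (pbracket P g f) - pbracket P (vapp X g) f - pbracket P g (vapp X f).
Proof. exact: pbracket_schouten (graded_P K). Qed.

(** The first two terms of the Lie derivative formula vanish. *)
Lemma deformed_casimir g C : (forall f, pbracket P f C = 0) ->
  pbracket P' g C = - pbracket P g (vapp X C).
Proof. by move=> PC; rewrite P'E !PC linear0 subr0 sub0r. Qed.

(** The hypothesis on m gives X_b {g, Q} - {X_b g, Q} = {g, m}. *)
Lemma deformed_Q g : pbracket P' g Q = pbracket P g M.
Proof.
rewrite P'E linearB /=; congr (_ - _).
have [_ /(congr1 (fun Y => vapp Y g))] := hm.
by rewrite vapp_schouten //; apply: graded_ham; apply: graded_P.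
Qed.

(** By [wedge_P_inj] it suffices to compare wedge products with P: that of P'(F) is
    given by [ham_F_wedge_P], and that of P(Q) by the equation that defines Q. *)
Lemma deformed_F g : pbracket P' g F = C2 K * pbracket P g Q.
Proof.
pose V (i : 'I_8) := pbracket P' 'X_i F - C2 K * pbracket P 'X_i Q.
have V0 : forall i, V i = 0.
  apply: (wedge_P_inj char0 b) => i j k ij jk.
  have := ham_F_wedge_P char0 b ij jk; rewrite -/P' -/F -/P.
  have [_ /(congr1 (fun R : mvfield K 8 => R (i |: [set j; k])))] := hQ.
  rewrite schouten_jacobiator //; last exact: graded_P'.
  rewrite ffunE wedge_vectorl3 //; last by apply: graded_ham; apply: graded_P.
  rewrite mulr_natl -scaler_nat => /(scalerI _) jacE.
  rewrite {}jacE ?char0 // => key.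
  have hamX l : ham P Q [set l] = pbracket P 'X_l Q by rewrite hamE pbracketXE.
  have combine (u v w q r s d e f a : {mpoly K[8]}) :
      u * d + v * e + w * f = a * (q * d + r * e + s * f) ->
      (u - a * q) * d + (v - a * r) * e + (w - a * s) * f = 0.
    by move=> /eqP; rewrite -subr_eq0 => /eqP <-; ring.
  by move: key; rewrite -/P !hamX; apply: combine.
rewrite !pbracketEl mulr_sumr; apply: eq_bigr => i _.
by rewrite mulrA; congr (_ * _); apply/eqP; rewrite -subr_eq0; apply/eqP/V0.
Qed.

Let C2P g : pbracket P g (C2 K) = 0 := C2_casimir char0 b g.
Let C3P g : pbracket P g (C3 K) = 0 := C3_casimir char0 b g.

Let deformed_C2 g : pbracket P' g (C2 K) = - pbracket P g F.
Proof. exact: deformed_casimir C2P. Qed.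

Let deformed_C3 g : pbracket P' g (C3 K) = 0.
Proof. by rewrite (deformed_casimir _ C3P) (Xb_C3 char0) linear0 oppr0. Qed.

Lemma involution_P : in_involution P [:: Q; F; M; C2 K; C3 K].
Proof. exact: (lenard_involution char0 C2P C3P deformed_Q deformed_C2 deformed_F). Qed.

Lemma involution_deformed : in_involution P' [:: Q; F; M; C2 K; C3 K].
Proof.
exact: (lenard_involution_deformed char0 C2P C3P deformed_Q deformed_C2 deformed_F
  deformed_C3).
Qed.

End Involution.

(** * The pencil on the dual of gl(3) *)

Notation widen8 := (widen_ord (leqnSn 8)).

Section Centralizer.

Variables (K : fieldType) (n : nat) (R : mvfield K n) (h : {mpoly K[n]}).
Implicit Types f g : {mpoly K[n]}.

Lemma centralizerD f g :
  pbracket R f h = 0 -> pbracket R g h = 0 -> pbracket R (f + g) h = 0.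
Proof. by move=> fh gh; rewrite pbracketDl fh gh addr0. Qed.

Lemma centralizerN f : pbracket R f h = 0 -> pbracket R (- f) h = 0.
Proof. by move=> fh; rewrite pbracketNl fh oppr0. Qed.

Lemma centralizerM f g :
  pbracket R f h = 0 -> pbracket R g h = 0 -> pbracket R (f * g) h = 0.
Proof. by move=> fh gh; rewrite pbracketMl fh gh mul0r mulr0 addr0. Qed.

Lemma centralizerX f k : pbracket R f h = 0 -> pbracket R (f ^+ k.+1) h = 0.
Proof.
by move=> fh; elim: k => [//|k IH]; rewrite exprS; apply: centralizerM.
Qed.

Lemma centralizer_nat k : pbracket R k%:R h = 0.
Proof.
rewrite pbracketEl big1 // => i _.
by rewrite -[k%:R]/(1 *+ k) mderivMn -mpolyC1 mderivC mul0rn mulr0.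
Qed.

End Centralizer.

Section Extension.

Variable K : fieldType.
Implicit Types (f g : {mpoly K[8]}) (R X : mvfield K 8).

Lemma mderiv_mwiden f (i : 'I_8) : (mwiden f)^`M(widen8 i) = mwiden f^`M(i).
Proof.
elim/mpolyind: f => [|a p f _ _ IH]; first by rewrite mwiden0 !mderiv0 mwiden0.
rewrite mwidenD mwidenZ !mderivD !mderivZ mwidenD mwidenZ IH; congr (_ *: _ + _).
rewrite mwidenX !mderivX mwidenZ mwidenX mnmwiden_widen; congr (_ *: 'X_[_]).
apply/mnmP=> j; rewrite mnmBE -mnmwiden1.
case: (unliftP ord_max j) => [k ->|->]; last by rewrite !mnmwiden_ordmax.
have -> : lift ord_max k = widen8 k by apply/val_inj; exact: lift_max.
by rewrite !mnmwiden_widen mnmBE.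
Qed.

Lemma mderiv_mwiden_max f : (mwiden f)^`M(@ord_max 8) = 0.
Proof.
elim/mpolyind: f => [|a p f _ _ IH]; first by rewrite mwiden0 mderiv0.
rewrite mwidenD mwidenZ mderivD mderivZ IH mwidenX mderivX mnmwiden_ordmax.
by rewrite scale0r scaler0 addr0.
Qed.

Lemma vapp_extend X f : vapp (mv_extend X) (mwiden f) = mwiden (vapp X f).
Proof.
rewrite !vappE big_ord_recr /= mderiv_mwiden_max mulr0 addr0 raddf_sum /=.
apply: eq_bigr => i _; rewrite mderiv_mwiden ffunE inE -val_eqE /= mwidenM.
rewrite (gtn_eqF (ltn_ord i)); congr (mwiden (X _) * _).
by apply/setP=> j; rewrite !inE.
Qed.

Lemma vapp_extend_x0 X : vapp (mv_extend X) (x0 K) = 0.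
Proof. by rewrite vappX ffunE set11. Qed.

Hypothesis char0 : forall m, (m%:R == 0 :> K) = (m == 0%N).
Variables (c : K) (c_neq0 : c != 0).

Lemma mvcoef_pi1 (i j : 'I_8) :
  mvcoef (pi1 c) (widen8 i) (widen8 j) = mwiden (mvcoef (P K) i j).
Proof.
rewrite !mvcoef_lie_poisson !gl3_basis_widen (linear_function_gl3 char0 c_neq0) //.
exact: lie_bracket_trace.
Qed.

Lemma mvcoef_pi1_max (i : 'I_9) : mvcoef (pi1 c) i ord_max = 0.
Proof.
rewrite mvcoef_lie_poisson gl3_basis_max /lie_bracket scalar_mxC subrr.
by rewrite /linear_function big1 // => k _; rewrite linear0 scale0r.
Qed.

Lemma pbracket_pi1 f g :
  pbracket (pi1 c) (mwiden f) (mwiden g) = mwiden (pbracket (P K) f g).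
Proof.
rewrite !pbracketE big_ord_recr /= mderiv_mwiden_max.
under eq_bigr do rewrite big_ord_recr /= mderiv_mwiden_max mulr0 mul0r addr0.
rewrite [X in _ + X]big1 ?addr0 => [|i _]; last by rewrite mulr0.
rewrite [RHS]raddf_sum /=; apply: eq_bigr => i _; rewrite [RHS]raddf_sum /=.
apply: eq_bigr => j _.
by rewrite /= !mderiv_mwiden mvcoef_pi1 !mwidenM.
Qed.

Lemma pbracket_pi1_x0 h : pbracket (pi1 c) h (x0 K) = 0.
Proof.
by rewrite pbracketEl big1 // => i _; rewrite pbracketXX mvcoef_pi1_max mul0r.
Qed.

Variables (b : 'rV[K]_10) (Q : {mpoly K[8]}).

Let P' := schouten (Xb b) (P K).

Lemma graded_pi1 : graded 2 (pi1 c).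
Proof. exact: graded_lie_poisson. Qed.

(** The extension of X_b and pi_1 act on pullbacks as X_b and P do, hence so does
    their Lie derivative. *)
Lemma pbracket_lie_pi1 f g :
  pbracket (schouten (mv_extend (Xb b)) (pi1 c)) (mwiden f) (mwiden g) =
  mwiden (pbracket P' f g).
Proof.
rewrite !pbracket_schouten; [|exact: graded_P|exact: graded_pi1].
by rewrite !vapp_extend !pbracket_pi1 vapp_extend !mwidenB.
Qed.

Lemma pbracket_lie_pi1_x0 f :
  pbracket (schouten (mv_extend (Xb b)) (pi1 c)) (mwiden f) (x0 K) = 0.
Proof.
rewrite pbracket_schouten; last exact: graded_pi1.
by rewrite vapp_extend_x0 !pbracket_pi1_x0 !linear0 !addr0.
Qed.

(** The middle term differentiates one of the two functions along x_0. *)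
Lemma pbracket_pi2 (f g : {mpoly K[9]}) :
  pbracket (pi2 c b Q) f g =
  pbracket (schouten (mv_extend (Xb b)) (pi1 c)) f g
  - (pbracket (pi1 c) f (mwiden Q) * g^`M(ord_max)
     - pbracket (pi1 c) g (mwiden Q) * f^`M(ord_max))
  + x0 K * pbracket (pi1 c) f g.
Proof.
rewrite 2!pbracketD pbracketN pbracket_fun_wedge pbracket_wedge.
- by rewrite !vapp_partial.
- exact: graded_ham graded_pi1.
exact: graded_partial.
Qed.

End Extension.

Section Pencil.

Variable K : fieldType.
Hypothesis char0 : forall m, (m%:R == 0 :> K) = (m == 0%N).
Variables (c : K) (c_neq0 : c != 0).
Variables (b : 'rV[K]_10) (Q m : {mpoly K[8]}).
Hypotheses (hQ : is_Qb b Q) (hm : is_mb b Q m).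
Variables l1 l2 : K.

Let F := vapp (Xb b) (C2 K).
Let M := m - vapp (Xb b) Q.
Let eta := l1 *: pi1 c + l2 *: pi2 c b Q.

(** On two pullbacks only P and P' contribute.  The bracket of x_0 with a pullback
    comes from the middle term of pi_2 and is a bracket with Q for P. *)
Lemma pencil_generators :
  in_involution eta (x0 K :: [seq mwiden f | f <- [:: Q; F; M; C2 K; C3 K]]).
Proof.
have invP := involution_P char0 hQ hm.
have invP' := involution_deformed char0 hQ hm.
refine (in_involution_cons char0 _ _) => [g|].
  case/mapP => f f_in ->; rewrite pbracketC pbracketD !pbracketZ pbracket_pi2.
  rewrite pbracket_lie_pi1_x0 // !pbracket_pi1_x0 // pbracket_pi1 // invP //;
    last by rewrite inE eqxx.
  by rewrite mderiv_mwiden_max mwiden0 !(mul0r, mulr0, subrr, addr0, scaler0, oppr0).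
have vanish (u v w : {mpoly K[9]}) :
    l1 *: 0 + l2 *: (0 - (u * 0 - v * 0) + w * 0) = 0 :> {mpoly K[9]}.
  by rewrite !mulr0 !subr0 addr0 !scaler0 addr0.
move=> _ _ /mapP[f f_in ->] /mapP[g g_in ->].
rewrite pbracketD !pbracketZ pbracket_pi2 pbracket_pi1 // invP // mwiden0.
rewrite pbracket_lie_pi1 // invP' // mwiden0 !mderiv_mwiden_max.
exact: vanish.
Qed.

(** The functions that commute with [h] form a subring. *)
Lemma pencil_span h :
  {in x0 K :: [seq mwiden f | f <- [:: Q; F; M; C2 K; C3 K]],
    forall g, pbracket eta g h = 0} ->
  {in [:: x0 K; B K; K1 K; K2 b; K3 b Q m; mwiden Q],
    forall g, pbracket eta g h = 0}.
Proof.
move=> gen0.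
have [x00 Q0 F0] : [/\ pbracket eta (x0 K) h = 0, pbracket eta (mwiden Q) h = 0
    & pbracket eta (mwiden F) h = 0].
  by split; apply: gen0; rewrite !inE eqxx ?orbT.
have [M0 B0 K10] : [/\ pbracket eta (mwiden M) h = 0, pbracket eta (B K) h = 0
    & pbracket eta (K1 K) h = 0].
  by split; apply: gen0; rewrite !inE eqxx ?orbT.
have K20 : pbracket eta (K2 b) h = 0.
  exact: (centralizerD F0 (centralizerM B0 x00)).
have K30 : pbracket eta (K3 b Q m) h = 0.
  have three := centralizer_nat eta h 3.
  refine (centralizerD (centralizerD _ _) (centralizerX 2 x00)).
    exact: (centralizerM (centralizerN three) M0).
  exact: (centralizerM (centralizerM three Q0) x00).
move=> g; rewrite !inE => /or4P[/eqP->|/eqP->|/eqP->|/or3P[]/eqP->].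
- exact: x00.
- exact: B0.
- exact: K10.
- exact: K20.
- exact: K30.
exact: Q0.
Qed.

Lemma pencil_involution :
  in_involution eta [:: x0 K; B K; K1 K; K2 b; K3 b Q m; mwiden Q].
Proof.
move=> g f g_in f_in; refine (pencil_span _ g_in) => g' g'_in.
rewrite pbracketC (pencil_span _ f_in) ?oppr0 // => g'' g''_in.
exact: pencil_generators.
Qed.

End Pencil.

Lemma char_real_or_complex (K : fieldType) : real_or_complex K ->
  forall m, (m%:R == 0 :> K) = (m == 0%N).
Proof. by case=> R m; rewrite Num.Theory.pnatr_eq0. Qed.

Theorem theorem7p2 (K : fieldType) (hK : real_or_complex K)
    (c : K) (hc : c != 0) (b : 'rV[K]_10) (Q m : {mpoly K[8]})
    (hQ : is_Qb b Q) (hm : is_mb b Q m) :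
  (forall l1 l2 : K,
     in_involution (l1 *: pi1 c + l2 *: pi2 c b Q)
       [:: x0 K; B K; K1 K; K2 b; K3 b Q m; mwiden Q])
  /\
  in_involution (P K)
    [:: Q; vapp (Xb b) (C2 K); m - vapp (Xb b) Q; C2 K; C3 K].
Proof.
have char0 := char_real_or_complex hK; split.
  by move=> l1 l2; exact: pencil_involution.
exact: involution_P hQ hm.
Qed.
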